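(* Let $1<p<\infty$, $T>0$, and let $\Omega$ be an arbitrary measurable subset of $\mathbb{R}^N$. Let $k\in W^{1,1}([0,T])$ be nonnegative and nonincreasing. Then for any $u\in L_p([0,T];L_p(\Omega))$ there holds $$|u(t)|_{L_p(\Omega)}^{p-1}\,\partial_t\big(k\ast|u(\cdot)|_{L_p(\Omega)}\big)(t)\le\int_\Omega|u(t,x)|^{p-2}u(t,x)\,\partial_t(k\ast u)(t,x)\,dx\quad\text{for a.a. }t\in(0,T).$$
   Context: $(k\ast v)(t)=\int_0^tk(t-\tau)v(\tau)\,d\tau$ is convolution in the time variable. Convention: $y|y|^{-\beta}$ is equal to $0$ for $y=0$ whenever $\beta\in(0,1)$ (relevant for $|u|^{p-2}u$ when $1<p<2$). *)

(* Defs.v *)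
From HB Require Import structures.
From mathcomp Require Export all_boot all_order all_algebra.
From mathcomp Require Export all_classical all_reals all_analysis.

Set Implicit Arguments.
Unset Strict Implicit.
Unset Printing Implicit Defensive.

Import Order.TTheory GRing.Theory Num.Theory.
Import numFieldNormedType.Exports.

Local Open Scope classical_set_scope.
Local Open Scope ring_scope.

Section borel_lebesgue_measure.
Variable R : realType.
Local Open Scope ereal_scope.
Local Notation RN N := (N.-tuple (measurableTypeR R)).

Definition tcons N (z : measurableTypeR R * RN N) : RN N.+1 :=
  [the N.+1.-tuple _ of z.1 :: z.2].

Lemma measurable_tcons N :
  measurable_fun [set: measurableTypeR R * RN N] (@tcons N).
Proof. exact: measurable_cons. Qed.

Lemma measurable_tconsI N (A : set (measurableTypeR R * RN N)) :
  measurable A -> measurable (@tcons N @` A).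
Proof.
pose f (x : RN N.+1) := (thead x, [tuple of behead x]).
have mf : measurable_fun [set: RN N.+1] f.
  by apply: measurable_fun_pair; [exact: measurable_tnth|
    exact: measurable_behead].
have fK : cancel f (@tcons N).
  by move=> x; rewrite [RHS]tuple_eta; apply/val_inj.
have tK : cancel (@tcons N) f.
  by move=> [a x]; congr pair; apply/val_inj.
move=> mA; rewrite (_ : _ @` _ = f @^-1` A).
  by rewrite -[X in measurable X]setTI; exact: mf.
by apply/seteqP; split=> [_ [z Az <-]|x Ax]; rewrite /preimage /= ?tK//;
  exists (f x).
Qed.

Section step.
Variables (N : nat) (mu : {sigma_finite_measure set (RN N) -> \bar R}).

Definition leb_step : set (RN N.+1) -> \bar R :=
  pushforward (lebesgue_measure \x mu) (@tcons N).

Let leb_step0 : leb_step set0 = 0.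
Proof. by rewrite /leb_step /pushforward preimage_set0 measure0. Qed.

Let leb_step_ge0 A : 0 <= leb_step A.
Proof. by apply: measure_ge0; exact: measurable_tcons. Qed.

Let leb_step_sigma_additive : semi_sigma_additive leb_step.
Proof.
by apply: measure_semi_sigma_additive; exact: measurable_tcons.
Qed.

HB.instance Definition _ := isMeasure.Build _ _ _ leb_step
  leb_step0 leb_step_ge0 leb_step_sigma_additive.

Let leb_step_sigma_finite : sigma_finite setT leb_step.
Proof.
have /sigma_finiteP[F [TF ndF Foo]] :=
  sigma_finiteT (@lebesgue_measure R : {sigma_finite_measure set _ -> \bar R}).
have /sigma_finiteP[G [TG ndG Goo]] := sigma_finiteT mu.
exists (fun n => @tcons N @` (F n `*` G n)).
  apply/esym; rewrite -subTset => x _.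
  have : [set: measurableTypeR R] (thead x) by [].
  have : [set: RN N] [tuple of behead x] by [].
  rewrite TF TG => -[k _ Gk] [n _ Fn]; exists (maxn n k) => //.
  exists (thead x, [tuple of behead x]).
    split; first by move: Fn; exact/subsetPset/ndF/leq_maxl.
    by move: Gk; exact/subsetPset/ndG/leq_maxr.
  by rewrite [RHS]tuple_eta; apply/val_inj.
move=> n; have [mF Fnoo] := Foo n; have [mG Gnoo] := Goo n.
split; first by apply: measurable_tconsI; exact: measurableX.
rewrite /leb_step /pushforward (_ : _ @^-1` _ = F n `*` G n).
  by rewrite product_measure1E// lte_mul_pinfty// ge0_fin_numE.
apply/seteqP; split=> [[a x] [[b y] FGby [ba yx]]|z Fz]; last by exists z.
by rewrite -ba -(val_inj yx).
Qed.

HB.instance Definition _ := Measure_isSigmaFinite.Build _ _ _ leb_step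
  leb_step_sigma_finite.
End step.

Fixpoint leb N : {sigma_finite_measure set (RN N) -> \bar R} :=
  match N with
  | 0 => \d_([tuple] : RN 0)
  | N.+1 => leb_step (leb N)
  end.

Lemma leb_box N (a b : 'I_N -> R) : (forall i, a i <= b i)%R ->
  leb N [set x | forall i, (a i < tnth x i <= b i)%R]
  = (\prod_(i < N) (b i - a i))%:E.
Proof.
elim: N => [|N IH] in a b * => ab.
  by rewrite big_ord0 /= diracE mem_set //; case.
pose B : set (RN N) :=
  [set x | forall i, (a (lift ord0 i) < tnth x i <= b (lift ord0 i))%R].
have mB : measurable B.
  rewrite (_ : B = \bigcap_(i in [set: 'I_N]) ((fun x : RN N => tnth x i) @^-1`
      [set` `]a (lift ord0 i), b (lift ord0 i)]])).
    apply: fin_bigcap_measurable => // i _.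
    by rewrite -[X in measurable X]setTI; apply: measurable_tnth.
  apply/seteqP; split=> [x Bx i _|x h i].
    by rewrite /preimage /= in_itv; exact: Bx.
  by have := h i I; rewrite /preimage /= in_itv.
rewrite /= /leb_step /pushforward.
rewrite (_ : _ @^-1` _ = [set` `]a ord0, b ord0]] `*` B).
  rewrite product_measure1E//= IH// lebesgue_measure_itv/= lte_fin.
  rewrite big_ord_recl EFinM.
  case: ltP => [//|ba].
  have -> : b ord0 = a ord0 by apply/eqP; rewrite eq_le ba ab.
  by rewrite subrr.
apply/seteqP; split=> [[c x] /= h|[c x] [/= hc hx] i].
  split; first by have := h ord0; rewrite in_itv.
  by move=> i; have := h (lift ord0 i); rewrite tnthS.
have [->|i0] := eqVneq i ord0; first by move: hc; rewrite in_itv.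
have [j ->] : exists j, i = lift ord0 j.
  by case: (unliftP ord0 i) i0 => [j ->|->]; [exists j|rewrite eqxx].
by rewrite tnthS.
Qed.
End borel_lebesgue_measure.

(* R^N with its sigma-algebra of Lebesgue (not only Borel) measurable sets,
   i.e. the Caratheodory sets of the outer measure induced by [leb R N]. *)
Notation Rn R N := (caratheodory_type ((@leb R N)^*)%mu).

Section lebesgue_measure_Rn.
Variables (R : realType) (N : nat).

Definition lebesgueRn : set (Rn R N) -> \bar R :=
  @completed_measure_extension _ _ _ (leb R N).

HB.instance Definition _ := Measure.on lebesgueRn.

Let lebesgueRn_sigma_finite : sigma_finite setT lebesgueRn.
Proof. exact/completed_measure_extension_sigma_finite/sigma_finiteT. Qed.

HB.instance Definition _ := Measure_isSigmaFinite.Build _ _ _ lebesgueRn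
  lebesgueRn_sigma_finite.

End lebesgue_measure_Rn.
Arguments lebesgueRn : clear implicits.

Section function_spaces.
Variable R : realType.
Local Notation mu1 := (@lebesgue_measure R).

Definition conv (k v : R -> R) (t : R) : R :=
  \int[mu1]_(tau in `[0, t]) (k (t - tau) * v tau).

Definition C1c (T : R) (phi : R -> R) : Prop :=
  [/\ forall t, derivable phi t 1,
      continuous (derive1 phi)
    & exists a b : R, [/\ 0 < a, b < T
        & forall t, phi t != 0 -> a <= t <= b] ].

(* [w] is the distributional derivative of [v] on ]0, T[. The integrability
   clauses are needed since \int is 0 on functions without finite integral. *)
Definition weak_derivative (T : R) (v w : R -> R) : Prop :=
  [/\ mu1.-integrable `]0, T[ (EFin \o v),
      mu1.-integrable `]0, T[ (EFin \o w)
    & forall phi, C1c T phi ->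
        \int[mu1]_(t in `]0, T[) (derive1 phi t * v t) =
        - \int[mu1]_(t in `]0, T[) (phi t * w t) ].

Definition W11 (T : R) (v : R -> R) : Prop := exists w, weak_derivative T v w.

Section vector_valued.
Variables (N : nat) (Omega : set (Rn R N)).

Definition Lp_norm (p : R) (f : Rn R N -> R) : \bar R :=
  'N[lebesgueRn R N]_(p%:E)[EFin \o (f \_ Omega)].

(* [u] represents an element of L_q([0,T]; L_p(Omega)): the class of the
   function t |-> u t in L_p(Omega), whose norm lies in L_q([0,T]).
   For finite p every class of that Bochner space has such a jointly measurable
   representative, unique up to a null set of [0,T] x Omega. *)
Definition LqLp (T q p : R) (u : R -> Rn R N -> R) : Prop :=
  measurable_fun (`[0, T] `*` Omega)
    (fun z : measurableTypeR R * Rn R N => u z.1 z.2) /\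
  ('N[mu1]_(q%:E)[(fun t => Lp_norm p (u t)) \_ `[0%R, T]] < +oo)%E.

Definition vconv (k : R -> R) (u : R -> Rn R N -> R) (t : R) (x : Rn R N) : R :=
  conv k (u^~ x) t.

(* The equation is an equality in L_p(Omega), so the exceptional null set
   may depend on the test function. *)
Definition weak_time_derivative (T p : R) (v w : R -> Rn R N -> R) : Prop :=
  [/\ LqLp T 1 p v, LqLp T 1 p w
    & forall phi, C1c T phi ->
        {ae lebesgueRn R N, forall x, Omega x ->
          \int[mu1]_(t in `]0, T[) (derive1 phi t * v t x) =
          - \int[mu1]_(t in `]0, T[) (phi t * w t x)} ].

End vector_valued.
End function_spaces.

(* Main.v *)
(* A nonincreasing k in W^{1,1} is k = c + int_0^t w almost everywhere with w <= 0
   integrable (du Bois-Reymond, and w <= 0 by testing against unimodal bumps),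
   so that d/dt (k * v) = c v + w * v for v integrable, scalar or vector-valued.
   The terms coming from c contribute c |u(t)|^p to both sides of the claim.
   For the remaining ones, Hoelder's inequality in space gives
     int |u(t)|^(p-2) u(t) u(s) dx <= |u(t)|^(p-1) |u(s)|
   and multiplying by w(t - s) <= 0 reverses it; integrate in s and use Fubini.
   No regularization of k is needed. Weak derivatives being unique up to null
   sets, the inequality for these explicit derivatives is enough. *)

Require Import Defs.
From mathcomp Require Import measurable_realfun ring lra.

Set Implicit Arguments.
Unset Strict Implicit.
Unset Printing Implicit Defensive.

Import Order.TTheory GRing.Theory Num.Theory.
Import numFieldNormedType.Exports.

Local Open Scope classical_set_scope.
Local Open Scope ring_scope.

(** Three obstacles shape the proof. In the vector-valued weak equation the exceptional null set
    varies with the test function, so signs and uniqueness are deduced from explicit bumps with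
    rational endpoints, a countable family. That equation speaks about almost all [x] and then
    almost all [t], whereas the claim needs the opposite order; joint measurability and Tonelli
    exchange the two. Finally, the norm of [u t] is finite for almost all [t] only, and a real
    integral is 0 when its extended value is infinite, so every use of linearity or Fubini must be
    backed by integrability: for the convolution [w * u] it comes from Young's inequality, for the
    double integral in space and time from the Hoelder bound itself. Functions of time are extended
    by 0 to the line, so that integrals over [[0, t]] become integrals over the line, where
    translations and reflections apply. *)

Section ae.
Context d (T : measurableType d) (R : realType) (mu : {measure set T -> \bar R}).
Implicit Types P Q S : T -> Prop.

Lemma ae_imply P Q : {ae mu, forall x, P x} -> (forall x, P x -> Q x) ->
  {ae mu, forall x, Q x}.
Proof. by move=> aeP PQ; apply: filterS aeP. Qed.

Lemma ae_imply2 P Q S : {ae mu, forall x, P x} -> {ae mu, forall x, Q x} ->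
  (forall x, P x -> Q x -> S x) -> {ae mu, forall x, S x}.
Proof. by move=> aeP aeQ PQS; apply: filterS2 aeP aeQ. Qed.

End ae.

(** * Invariance of Lebesgue measure under reflections and translations *)

Section reflection.
Context {R : realType}.
Local Notation leb := (@lebesgue_measure R).
Local Open Scope ereal_scope.

Lemma measurable_reflect (t : R) :
  measurable_fun [set: measurableTypeR R]
    ((fun s => t - s)%R : measurableTypeR R -> measurableTypeR R).
Proof. exact: measurable_funB. Qed.

Lemma lebesgue_measure_reflect (t : R) (A : set R) : measurable A ->
  pushforward leb ((fun s => t - s)%R : measurableTypeR R -> measurableTypeR R) A
  = leb A.
Proof.
move=> mA; apply/esym/lebesgue_measure_unique => //=.
  exact: measurable_reflect.
move=> ? _ [[a b]] _ <-; rewrite /pushforward /=.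
(* The reflection exchanges the open and the closed endpoint; only the length counts. *)
rewrite (_ : _ @^-1` _ = `[(t - b)%R, (t - a)%R[%classic).
  rewrite !lebesgue_measure_itv/= !lte_fin ltrD2l ltrN2.
  by case: ifPn => // _; rewrite -!EFinB; congr EFin; ring.
by apply/seteqP; split => x /=; rewrite !in_itv/= => /andP[h1 h2];
  apply/andP; split; lra.
Qed.

Lemma ge0_integral_reflect (t : R) (f : R -> \bar R) :
  measurable_fun [set: R] f -> (forall r, 0 <= f r) ->
  \int[leb]_s f (t - s)%R = \int[leb]_s f s.
Proof.
move=> mf f0.
have -> := esym (ge0_integral_pushforward (measurable_reflect t) leb
  measurableT mf (in1W f0)).
apply: eq_measure_integral; first exact: measurable_reflect.
by move=> *; exact: lebesgue_measure_reflect.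
Qed.

(** A translation is the composite of the two reflections [x -> 0 - x] and [x -> s - x]. *)
Lemma ge0_integral_shift (s : R) (f : R -> \bar R) :
  measurable_fun [set: R] f -> (forall r, 0 <= f r) ->
  \int[leb]_t f (t - s)%R = \int[leb]_t f t.
Proof.
move=> mf f0.
have mN : measurable_fun setT (fun x : R => f (0 - x)%R).
  by apply: measurableT_comp => //; exact: measurable_reflect.
rewrite -[RHS](ge0_integral_reflect 0)// -[RHS](ge0_integral_reflect s)//.
by apply: eq_integral => x _; congr f; ring.
Qed.

(** A function is null almost everywhere exactly when its absolute value has integral 0, and that
    integral is invariant under reflection. Serves to replace [k] by a representative inside a
    convolution, where it is evaluated at [t - s]. *)
Lemma ae_reflect (t : R) (f : R -> R) : measurable_fun setT f ->
  f = cst 0%R %[ae leb] -> (fun s => f (t - s)%R) = cst 0%R %[ae leb].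
Proof.
move=> mf f0.
have mfE : measurable_fun setT (EFin \o f) by exact/measurable_EFinP.
have h : \int[leb]_x `|(EFin \o f) x| = 0.
  apply/ae_eq_integral_abs => //.
  by apply: ae_imply f0 _ => x /= fx Dx; rewrite fx.
have : \int[leb]_x `|(f (t - x))%:E| = 0.
  rewrite -h -(ge0_integral_reflect t (f := fun x => `|(EFin \o f) x|))//.
  by apply: measurableT_comp.
move/ae_eq_integral_abs => /(_ measurableT) H.
have fE : ae_eq leb setT (fun x => (f (t - x))%:E) (cst 0).
  apply: H; apply: (measurableT_comp mfE); exact: measurable_reflect.
by apply: ae_imply fE _ => x /= fx _; have [] := fx I.
Qed.

End reflection.

(** * Fubini's theorem for real-valued integrals *)

Section fubini_supplement.
Local Open Scope ereal_scope.
Context d1 d2 (T1 : measurableType d1) (T2 : measurableType d2) (R : realType).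
Variable m1 : {sigma_finite_measure set T1 -> \bar R}.
Variable m2 : {sigma_finite_measure set T2 -> \bar R}.

Lemma measurable_fun_integral2 (f : T1 * T2 -> \bar R) :
  measurable_fun setT f -> measurable_fun setT (fun x => \int[m2]_y f (x, y)).
Proof.
move=> mf.
rewrite (_ : (fun x => _) = (fun x => \int[m2]_y (f^\+ (x, y)) -
    \int[m2]_y (f^\- (x, y)))); last first.
  apply/funext => x; rewrite [LHS]integralE.
  under eq_integral do rewrite funepos_comp/=.
  by under [X in _ - X = _]eq_integral do rewrite funeneg_comp/=.
apply: emeasurable_funB.
  by apply: measurable_fun_fubini_tonelli_F => //; exact: measurable_funepos.
by apply: measurable_fun_fubini_tonelli_F => //; exact: measurable_funeneg.
Qed.

Lemma measurable_fun_Rintegral2 (f : T1 * T2 -> R) : measurable_fun setT f ->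
  measurable_fun setT (fun x => \int[m2]_y f (x, y))%R.
Proof.
move=> mf; apply: measurableT_comp => //.
by apply: (measurable_fun_integral2 (f := EFin \o f)); exact/measurable_EFinP.
Qed.

Lemma ae_fin_num_integral2 (f : T1 * T2 -> \bar R) :
  (m1 \x m2).-integrable setT f ->
  {ae m1, forall x, (\int[m2]_y f (x, y)) \is a fin_num}.
Proof.
move=> intf; have := integrable_ae measurableT (integrable_fubini_F intf).
by move=> h; apply: ae_imply h _ => x /= /(_ I).
Qed.

Lemma integrable_Rintegral2 (f : T1 * T2 -> R) :
  (m1 \x m2).-integrable setT (EFin \o f) ->
  m1.-integrable setT (fun x => (\int[m2]_y f (x, y))%R%:E).
Proof.
move=> intf; have intF := integrable_fubini_F intf.
have mf : measurable_fun setT f by apply/measurable_EFinP; exact: measurable_int _ intf.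
apply: le_integrable intF => //.
  by apply/measurable_EFinP; exact: measurable_fun_Rintegral2.
(* [fine] turns an infinite inner integral into 0, so absolute values can only decrease. *)
move=> x _ /=; rewrite /fubini_F /Rintegral /=.
by case: (\int[m2]_y _) => //=; rewrite ?normr0 ?lee_fin// leey.
Qed.

Lemma Rintegral_fubini1 (f : T1 * T2 -> R) :
  (m1 \x m2).-integrable setT (EFin \o f) ->
  (\int[m1]_x \int[m2]_y f (x, y) = \int[m1 \x m2]_z f z)%R.
Proof.
move=> intf; rewrite /Rintegral; congr fine.
have intf2 := integrable_Rintegral2 intf.
rewrite -[RHS](integral12_prod_meas1 intf).
apply: ae_eq_integral => //.
- exact: measurable_int _ intf2.
- exact: measurable_int _ (integrable_fubini_F intf).
- apply: ae_imply (ae_fin_num_integral2 intf) _ => x hx _ /=.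
  by rewrite fineK.
Qed.

End fubini_supplement.

Section fubini_swap.
Local Open Scope ereal_scope.
Context d1 d2 (T1 : measurableType d1) (T2 : measurableType d2) (R : realType).
Variable m1 : {sigma_finite_measure set T1 -> \bar R}.
Variable m2 : {sigma_finite_measure set T2 -> \bar R}.

Lemma measurable_swap_pair : measurable_fun setT (fun z : T2 * T1 => (z.2, z.1)).
Proof. exact: measurable_swap. Qed.

Lemma integrable_swap (f : T1 * T2 -> R) :
  (m1 \x m2).-integrable setT (EFin \o f) ->
  (m2 \x m1).-integrable setT (fun z => (f (z.2, z.1))%:E).
Proof.
move=> intf; have mf := measurable_int _ intf.
have mg : measurable_fun setT (fun z : T2 * T1 => (f (z.2, z.1))%:E).
  by apply: (measurableT_comp mf); exact: measurable_swap_pair.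
apply/integrable12ltyP => //=.
by move/integrable21ltyP : intf => /(_ mf).
Qed.

Lemma Rintegral_fubini (f : T1 * T2 -> R) :
  (m1 \x m2).-integrable setT (EFin \o f) ->
  (\int[m1]_x \int[m2]_y f (x, y) = \int[m2]_y \int[m1]_x f (x, y))%R.
Proof.
move=> intf; rewrite Rintegral_fubini1//.
have intg := integrable_swap intf.
rewrite (Rintegral_fubini1 intg) /Rintegral; congr fine.
by rewrite -(integral21_prod_meas1 intf) -(integral12_prod_meas1 intg).
Qed.

Lemma integrable_tensor (f : T1 -> R) (g : T2 -> R) :
  m1.-integrable setT (EFin \o f) -> m2.-integrable setT (EFin \o g) ->
  (m1 \x m2).-integrable setT (fun z => (f z.1 * g z.2)%:E).
Proof.
move=> /integrableP[mf lf] /integrableP[mg lg].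
have mF : measurable_fun setT (fun z : T1 * T2 => (f z.1 * g z.2)%:E).
  apply/measurable_EFinP; apply: measurable_funM.
    by apply: measurableT_comp; [exact/measurable_EFinP|exact: measurable_fst].
  by apply: measurableT_comp; [exact/measurable_EFinP|exact: measurable_snd].
apply/integrable12ltyP => //=.
rewrite (eq_integral (fun x => `|(f x)%:E| * \int[m2]_y `|(g y)%:E|)); last first.
  move=> x _; rewrite -ge0_integralZl//; last exact: measurableT_comp.
  by apply: eq_integral => y _; rewrite normrM EFinM.
rewrite ge0_integralZr//; last 2 first.
  exact: measurableT_comp.
  exact: integral_ge0.
by apply: lte_mul_pinfty => //; [exact: integral_ge0|
  rewrite ge0_fin_numE//; exact: integral_ge0].
Qed.

End fubini_swap.

(** * Integrability of the convolution integrand on the line *)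

Section convolution.
Context {R : realType}.
Local Notation leb := (@lebesgue_measure R).

Lemma integral_shift (s : R) (f : R -> \bar R) :
  measurable_fun [set: R] f ->
  (\int[leb]_t f (t - s)%R = \int[leb]_t f t)%E.
Proof.
move=> mf; rewrite integralE [RHS]integralE.
congr (_ - _)%E.
  rewrite -(ge0_integral_shift s (f := f^\+%E))//.
    by apply: eq_integral => x _; rewrite -[RHS]/(((f^\+)%E \o (fun t : R => t - s)) x) -funepos_comp.
  exact: measurable_funepos.
rewrite -(ge0_integral_shift s (f := f^\-%E))//.
  by apply: eq_integral => x _; rewrite -[RHS]/(((f^\-)%E \o (fun t : R => t - s)) x) -funeneg_comp.
exact: measurable_funeneg.
Qed.

Lemma integrable_conv (f g : R -> R) :
  leb.-integrable setT (EFin \o f) -> leb.-integrable setT (EFin \o g) ->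
  (leb \x leb)%E.-integrable setT (fun z => (f (z.1 - z.2) * g z.2)%:E).
Proof.
move=> /integrableP[mf lf] /integrableP[mg lg].
have mF : measurable_fun setT
    (fun z : measurableTypeR R * measurableTypeR R => (f (z.1 - z.2) * g z.2)%:E).
  apply/measurable_EFinP; apply: measurable_funM.
    apply: measurableT_comp; first exact/measurable_EFinP.
    by apply: measurable_funB; [exact: measurable_fst|exact: measurable_snd].
  by apply: measurableT_comp; [exact/measurable_EFinP|exact: measurable_snd].
(* With the integral in [z.1] taken first, translation invariance makes the inner integral the L_1
   norm of [f] times [|g y|]. *)
apply/integrable21ltyP => //=.
rewrite (eq_integral (fun y : measurableTypeR R => (\int[leb]_x `|(f x)%:E|) * `|(g y)%:E|)%E); last first.
  move=> y _; rewrite -(ge0_integral_shift y)//; last exact: measurableT_comp.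
  rewrite -ge0_integralZr//.
    by apply: eq_integral => x _; rewrite normrM EFinM.
  apply: measurableT_comp => //; apply: (measurableT_comp mf).
  by apply: measurable_funB.
rewrite ge0_integralZl//; last 2 first.
  exact: measurableT_comp.
  exact: integral_ge0.
by apply: lte_mul_pinfty => //; [exact: integral_ge0|
  rewrite ge0_fin_numE//; exact: integral_ge0].
Qed.

End convolution.

(** * Explicit C^1 bump functions *)

Section bump.
Context {R : realType}.
Implicit Types (a b t x : R) (n : nat).

(** For [pos2], which is defined by cases, a quadratic bound on the remainder reduces
    differentiability to polynomial inequalities, also at the point 0 where the cases meet. *)
Lemma is_derive_quadratic (f : R -> R) (x l C : R) :
  (forall h, `|f (h + x) - f x - l * h| <= C * h ^+ 2) -> is_derive x 1 f l.
Proof.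
move=> fl.
have fcvg : h^-1 *: (f (h *: 1 + x) - f x) @[h --> 0^'] --> l.
  (* [C] may be zero or negative, while [D] serves as a denominator below. *)
  have [D D0 CD] : exists2 D, 0 < D & C <= D.
    by exists (`|C| + 1); [rewrite ltr_wpDl|rewrite (le_trans (ler_norm C))// lerDl].
  apply/cvgrPdist_le => e e0; near=> h.
  have h0 : h != 0 by near: h; exact: nbhs_dnbhs_neq.
  have hn : 0 < `|h| by rewrite normr_gt0.
  rewrite -[h *: 1]/(h * 1) mulr1 -[_ *: _]/(_ * _).
  rewrite -(ler_pM2l hn) -normrM.
  have -> : h * (l - h^-1 * (f (h + x) - f x)) = - (f (h + x) - f x - l * h).
    by field.
  rewrite normrN (le_trans (fl h))// -[h ^+ 2]ger0_norm ?sqr_ge0// expr2 normrM.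
  rewrite mulrA mulrC ler_pM2l//.
  apply: (@le_trans _ _ (D * `|h|)); first by rewrite ler_wpM2r.
  rewrite mulrC -ler_pdivlMr//.
  by near: h; apply: dnbhs0_le; rewrite divr_gt0.
have df : derivable f x 1 by apply/cvg_ex; exists l.
by apply: DeriveDef => //; exact: cvg_lim fcvg.
Unshelve. all: by end_near. Qed.

Definition pos2 x : R := Num.max x 0 ^+ 2.

Lemma is_derive_pos2 x : is_derive x 1 pos2 (2 * Num.max x 0).
Proof.
apply: (@is_derive_quadratic _ _ _ 1) => h; rewrite /pos2 mul1r ler_norml.
by have [?|?] := leP x 0; have [?|?] := leP (h + x) 0;
  apply/andP; split; nra.
Qed.

(* [bump n a b] is C^1, null off ]a, b[, unimodal with its maximum at the
   midpoint, and tends to 1 on ]a, b[ as [n] grows. *)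
Definition ramp x : R := 1 - (1 + pos2 x)^-1.
Definition bump n a b t : R := ramp (n%:R * ((t - a) * (b - t))).
Definition bump_derive n a b t : R :=
  let x := n%:R * ((t - a) * (b - t)) in
  (1 + pos2 x) ^- 2 * (2 * Num.max x 0) * (n%:R * (a + b - 2 * t)).

Lemma pos2_ge0 x : 0 <= pos2 x. Proof. exact: sqr_ge0. Qed.

Lemma pos2_gt0 x : 0 < 1 + pos2 x.
Proof. by rewrite ltr_pwDl// pos2_ge0. Qed.

Lemma ramp_ge0 x : 0 <= ramp x.
Proof. by rewrite subr_ge0 invf_le1 ?pos2_gt0// lerDl pos2_ge0. Qed.

Lemma ramp_le1 x : ramp x <= 1.
Proof. by rewrite gerBl invr_ge0 ltW// pos2_gt0. Qed.

Lemma ramp_eq0 x : x <= 0 -> ramp x = 0.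
Proof.
by move=> x0; rewrite /ramp /pos2 max_r// expr0n/= addr0 invr1 subrr.
Qed.

Lemma is_derive_ramp x :
  is_derive x 1 ramp ((1 + pos2 x) ^- 2 * (2 * Num.max x 0)).
Proof.
have d0 := is_derive_pos2 x.
have d1 : is_derive x 1 (fun x => 1 + pos2 x) (2 * Num.max x 0).
  by rewrite -[X in is_derive _ _ _ X]add0r; exact: is_deriveD.
have d2 := @is_deriveV _ (fun x => 1 + pos2 x) _ _ _ (lt0r_neq0 (pos2_gt0 x)) d1.
rewrite (_ : _ * _ = 0 - (- (1 + pos2 x) ^- 2 *: (2 * Num.max x 0))).
  exact: is_deriveB.
by rewrite -[_ *: _]/(_ * _); ring.
Qed.

Lemma is_derive_bump n a b t : is_derive t 1 (bump n a b) (bump_derive n a b t).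
Proof.
apply: (@is_derive1_comp _ ramp); first exact: is_derive_ramp.
apply: (@is_derive_quadratic _ _ _ n%:R) => h.
rewrite (_ : _ - _ - _ = - (n%:R * h ^+ 2)); last by ring.
by rewrite normrN ger0_norm// mulr_ge0// sqr_ge0.
Qed.

Lemma derive1_bump n a b : derive1 (bump n a b) = bump_derive n a b.
Proof.
by apply/funext => t; rewrite derive1E; have [_ ->] := is_derive_bump n a b t.
Qed.

Lemma continuous_pos2 : continuous pos2.
Proof.
move=> x; apply: differentiable_continuous; apply/derivable1_diffP.
by have [] := is_derive_pos2 x.
Qed.

Lemma continuous_bump_derive n a b : continuous (bump_derive n a b).
Proof.
move=> t; rewrite /bump_derive.
have cx : {for t, continuous (fun t => n%:R * ((t - a) * (b - t)))}.
  apply: cvgM; first exact: cvg_cst.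
  by apply: cvgM; apply: cvgB; do ?exact: cvg_cst; exact: cvg_id.
apply: cvgM; first apply: cvgM.
- apply: cvgV; first by rewrite expf_neq0// gt_eqF// pos2_gt0.
  have c1 : {for t, continuous (fun t => 1 + pos2 (n%:R * ((t - a) * (b - t))))}.
    apply: cvgD; first exact: cvg_cst.
    exact: (continuous_comp cx (@continuous_pos2 _)).
  by under eq_fun do rewrite expr2; rewrite expr2; exact: cvgM.
- apply: cvgM; first exact: cvg_cst.
  have cm : continuous (fun x : R => Num.max x 0).
    by move=> x; apply: (@continuous_max R R^o id (cst 0)); [exact: cvg_id|exact: cvg_cst].
  exact: (continuous_comp cx (cm _)).
- apply: cvgM; first exact: cvg_cst.
  apply: cvgB; first exact: cvg_cst.
  by apply: cvgM; [exact: cvg_cst|exact: cvg_id].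
Qed.

Lemma bump_ge0 n a b t : 0 <= bump n a b t. Proof. exact: ramp_ge0. Qed.

Lemma bump_le1 n a b t : bump n a b t <= 1. Proof. exact: ramp_le1. Qed.

Lemma bump_eq0 n a b t : a <= b -> ~ (a < t < b) -> bump n a b t = 0.
Proof.
move=> ab tab; apply: ramp_eq0; rewrite mulr_ge0_le0//.
have [ta|ta] := leP t a; first nra.
by have [tb|tb] := leP b t; [nra|case: tab; rewrite ta tb].
Qed.

Lemma bump_derive_ge0 n a b t : t <= (a + b) / 2 -> 0 <= bump_derive n a b t.
Proof.
move=> t2; rewrite /bump_derive mulr_ge0//.
  by rewrite !mulr_ge0// ?invr_ge0 ?sqr_ge0// le_max lexx orbT.
by rewrite mulr_ge0//; lra.
Qed.

Lemma bump_derive_le0 n a b t : (a + b) / 2 <= t -> bump_derive n a b t <= 0.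
Proof.
move=> t2; rewrite /bump_derive mulr_ge0_le0//.
  by rewrite !mulr_ge0// ?invr_ge0 ?sqr_ge0// le_max lexx orbT.
by rewrite mulr_ge0_le0//; lra.
Qed.

Lemma C1c_bump T n a b : 0 < a -> a <= b -> b < T -> C1c T (bump n a b).
Proof.
move=> a0 ab bT; split.
- by move=> t; have [] := is_derive_bump n a b t.
- by rewrite derive1_bump; exact: continuous_bump_derive.
- exists a, b; split => // t; apply: contraNT => h.
  apply/eqP/bump_eq0 => // /andP[at_ tb]; case/negP: h.
  by rewrite !ltW.
Qed.

Lemma cvg_bump a b t : a < t < b -> bump n a b t @[n --> \oo] --> (1 : R).
Proof.
move=> /andP[at_ tb].
set c := (t - a) * (b - t).
have c0 : 0 < c by rewrite mulr_gt0// subr_gt0.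
rewrite /bump /ramp -[X in _ --> X]subr0.
apply: cvgB; first exact: cvg_cst.
apply/cvgrPdist_le => e e0; near=> n.
rewrite sub0r normrN ger0_norm; last by rewrite invr_ge0 ltW// pos2_gt0.
rewrite -/c -[leRHS]invrK lef_pV2 ?posrE ?invr_gt0 ?pos2_gt0//.
have nc : 1 + e^-1 <= n%:R * c.
  by rewrite -ler_pdivrMr//; near: n; exact: nbhs_infty_ger.
have ei : 0 < e^-1 by rewrite invr_gt0.
rewrite /pos2 max_l; nra.
Unshelve. all: by end_near. Qed.

End bump.

Lemma integrable_patchP d (T : measurableType d) (R : realType)
    (mu : {measure set T -> \bar R}) (D : set T) (f : T -> R) : measurable D ->
  mu.-integrable D (EFin \o f) <-> mu.-integrable setT (EFin \o (f \_ D)).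
Proof. by move=> mD; rewrite -restrict_EFin; exact: integrable_mkcond. Qed.

Section integrableZ.
Context d (T : measurableType d) (R : realType) (mu : {measure set T -> \bar R}).
Variables (D : set T) (mD : measurable D) (f : T -> R) (r : R).
Hypothesis intf : mu.-integrable D (EFin \o f).

Lemma integrableZlR : mu.-integrable D (fun t => (r * f t)%:E).
Proof. by move: (integrableZl mD r intf); apply: eq_integrable. Qed.

Lemma integrableZrR : mu.-integrable D (fun t => (f t * r)%:E).
Proof. by move: (integrableZr mD r intf); apply: eq_integrable. Qed.

End integrableZ.

(** * Test functions and their integrals *)

Section test_functions.
Context {R : realType}.
Local Notation leb := (@lebesgue_measure R).
Implicit Types (T : R) (phi : R -> R).

Lemma C1c_continuous T phi : C1c T phi -> continuous phi.
Proof.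
by move=> [dphi _ _] t; apply: differentiable_continuous; exact/derivable1_diffP.
Qed.

Lemma C1c_eq0 T phi t : C1c T phi -> T <= t -> phi t = 0.
Proof.
move=> [_ _ [a [b [_ bT h]]]] Tt; apply/eqP; apply: contraT => /h /andP[_ tb].
by have := lt_le_trans bT (le_trans Tt tb); rewrite ltxx.
Qed.

Lemma C1c_eq0N T phi t : C1c T phi -> t <= 0 -> phi t = 0.
Proof.
move=> [_ _ [a [b [a0 _ h]]]] Tt; apply/eqP; apply: contraT => /h /andP[at_ _].
by have := lt_le_trans a0 (le_trans at_ Tt); rewrite ltxx.
Qed.

Lemma continuous_integrable_itv (f : R -> R) (a b : R) : continuous f ->
  leb.-integrable `]a, b[ (EFin \o f).
Proof.
move=> cf; apply: (@integrableS _ (measurableTypeR R) R leb `[a, b]%classic) => //.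
  exact: subset_itv_oo_cc.
apply: continuous_compact_integrable; first exact: segment_compact.
exact: continuous_subspaceT.
Qed.

Lemma C1c_integrable_derive T phi : C1c T phi ->
  leb.-integrable `]0, T[ (EFin \o derive1 phi).
Proof. by move=> [_ cphi _]; exact: continuous_integrable_itv. Qed.

Lemma integrable_continuousM (f g : R -> R) (a b : R) : continuous f ->
  leb.-integrable `]a, b[ (EFin \o g) ->
  leb.-integrable `]a, b[ (fun t => (f t * g t)%:E).
Proof.
move=> cf ig; have [M hM] : exists M, forall t, `]a, b[%classic t -> `|f t| <= M.
  have [ab|ba] := leP a b; last first.
    by exists 0 => t /=; rewrite in_itv/= => /andP[/lt_trans h /h];
      rewrite ltNge (ltW ba).
  have cn : {within `[a, b], continuous (fun t => `|f t|)}.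
    by apply: continuous_subspaceT => t; apply: cvg_norm; exact: cf.
  have [c _ hc] := EVT_max ab cn.
  by exists `|f c| => t /= /subset_itv_oo_cc; exact: hc.
apply: (@le_integrable _ (measurableTypeR R) R leb `]a, b[%classic _ _
  (fun t => M%:E * (g t)%:E)%E) => //.
- apply/measurable_EFinP/measurable_funM => //.
    by apply: measurable_funTS; exact: continuous_measurable_fun.
  by apply/measurable_EFinP; exact: measurable_int _ ig.
- move=> t tI /=; rewrite lee_fin !normrM ler_wpM2r//.
  by rewrite (le_trans (hM _ tI))// ler_norm.
- exact: integrableZl.
Qed.

Lemma C1c_integrable T phi w : C1c T phi ->
  leb.-integrable `]0, T[ (EFin \o w) ->
  leb.-integrable `]0, T[ (fun t => (phi t * w t)%:E).
Proof. by move=> /C1c_continuous; exact: integrable_continuousM. Qed.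

Lemma Rintegral_derive_C1c T phi s : C1c T phi -> s < T ->
  \int[leb]_(t in `]s, T[) derive1 phi t = - phi s.
Proof.
move=> Cphi sT; have [dphi cphi _] := Cphi; rewrite /Rintegral.
have mphi : measurable_fun `]s, T[ (fun t => (derive1 phi t)%:E).
  apply/measurable_EFinP; apply: measurable_funTS.
  exact: continuous_measurable_fun.
rewrite -(@integral_itv_bndoo _ s T (fun t => (derive1 phi t)%:E) true false)//.
rewrite (continuous_FTC2 sT (F := phi))//.
- by rewrite (C1c_eq0 Cphi (lexx T)) -EFinB/= sub0r.
- exact: continuous_subspaceT.
- split=> //.
    apply: cvg_at_right_filter; exact: (C1c_continuous Cphi).
  apply: cvg_at_left_filter; exact: (C1c_continuous Cphi).
Qed.

Lemma Rintegral_derive_C1c0 T phi : C1c T phi -> 0 < T ->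
  \int[leb]_(t in `]0, T[) derive1 phi t = 0.
Proof.
by move=> Cphi T0; rewrite Rintegral_derive_C1c// (C1c_eq0N Cphi)// oppr0.
Qed.

End test_functions.

(** * Primitives of integrable functions have weak derivatives *)

Section primitive.
Context {R : realType}.
Local Notation leb := (@lebesgue_measure R).
Variables (T : R) (w : R -> R).
Hypothesis iw : leb.-integrable `]0, T[ (EFin \o w).

Definition primitive (t : R) := \int[leb]_(s in `]0, t[) w s.

Let w0 := w \_ `]0, T[.

Let iw0 : leb.-integrable setT (EFin \o w0).
Proof. by apply: (integrable_patchP leb w _).1. Qed.

Let primitiveE t : t <= T ->
  primitive t = \int[leb]_s (if s < t then w0 s else 0).
Proof.
move=> tT; rewrite /primitive Rintegral_mkcond; apply: eq_Rintegral => s _.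
rewrite /w0 !patchE; case: ifPn => [/set_mem/=|].
  rewrite in_itv/= => /andP[s0 st]; rewrite st mem_set//=.
  by rewrite in_itv/= s0 (lt_le_trans st tT).
move=> /negP st; case: ifPn => // st1; case: ifPn => // /set_mem/=.
rewrite in_itv/= => /andP[s0 _]; case: st; apply/mem_set.
by rewrite /= in_itv/= s0 st1.
Qed.

Let integrable_triangle (P : R -> R) : leb.-integrable setT (EFin \o P) ->
  (leb \x leb)%E.-integrable setT
    (fun z => (P z.1 * (if z.2 < z.1 then w0 z.2 else 0))%:E).
Proof.
move=> iP; apply: le_integrable (integrable_tensor iP iw0) => //.
  apply/measurable_EFinP; apply: measurable_funM.
    apply: (measurableT_comp _ (@measurable_fst _ _ _ _)).
    by apply/measurable_EFinP; exact: measurable_int iP.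
  apply: measurable_fun_ifT => //.
    by apply: measurable_fun_ltr; [exact: measurable_snd|exact: measurable_fst].
  apply: (measurableT_comp _ (@measurable_snd _ _ _ _)).
  by apply/measurable_EFinP; exact: measurable_int iw0.
move=> [t s] _ /=; rewrite lee_fin !normrM ler_wpM2l//.
by case: ifPn => // _; rewrite normr0.
Qed.

(** Fubini on the triangle [0 < s < t < T]: pairing [phi'] with the primitive gives the integral of
    [w s] times the integral of [phi'] over []s, T[], which is [- phi s]. *)
Lemma weak_derivative_primitive : 0 < T -> weak_derivative T primitive w.
Proof.
move=> T0.
(* With this weight in the triangle, integration in [s] yields the primitive cut to []0, T[], hence
   its integrability. *)
have i1 : leb.-integrable setT (EFin \o (\1_`]0, T[ : R -> R)).
  apply: integrable_indic_itv.
split => //.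
  apply/integrable_patchP => //.
  have := integrable_Rintegral2 (integrable_triangle i1).
  apply: eq_integrable => // t _ /=; rewrite patchE indicE.
  have [/set_mem/=|_] := boolP (t \in _); last first.
    by under eq_Rintegral do rewrite mul0r; rewrite Rintegral_cst// mul0r.
  rewrite in_itv/= => /andP[t0 tT]; rewrite primitiveE ?ltW//.
  by congr EFin; apply: eq_Rintegral => s _; exact: mul1r.
move=> phi Cphi.
pose P := (derive1 phi) \_ `]0, T[.
have iP : leb.-integrable setT (EFin \o P).
  by apply: (integrable_patchP leb _ _).1 => //; exact: C1c_integrable_derive.
have itr t : leb.-integrable setT (fun s => (if s < t then w0 s else 0)%:E).
  apply: le_integrable iw0 => //.
    apply/measurable_EFinP; apply: measurable_fun_ifT => //.
      by apply: measurable_fun_ltr.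
    by apply/measurable_EFinP; exact: measurable_int iw0.
  by move=> s _ /=; rewrite lee_fin; case: ifPn => // _; rewrite normr0.
transitivity (\int[leb]_t \int[leb]_s (P t * (if s < t then w0 s else 0))).
  rewrite Rintegral_mkcond; apply: eq_Rintegral => t _; rewrite /P !patchE.
  case: ifPn => [/set_mem/=|_]; last first.
    by under eq_Rintegral do rewrite mul0r; rewrite Rintegral_cst// mul0r.
  rewrite in_itv/= => /andP[t0 tT]; rewrite primitiveE ?ltW//.
  rewrite RintegralZl//; exact: itr.
rewrite (Rintegral_fubini (integrable_triangle iP)).
rewrite [in RHS]Rintegral_mkcond -[RHS]mulN1r -RintegralZl//; last first.
  by apply: (integrable_patchP leb _ _).1 => //; exact: C1c_integrable.
apply: eq_Rintegral => s _ /=; rewrite patchE mulN1r.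
have [sI|sT] := boolP (s \in `]0, T[%classic); last first.
  rewrite oppr0 -[RHS](mul0r (fine (leb setT))) -Rintegral_cst//.
  apply: eq_Rintegral => t _.
  by rewrite /w0 patchE (negbTE sT); case: ifP; rewrite mulr0.
move: (set_mem sI); rewrite /= in_itv/= => /andP[s0 sltT].
rewrite -mulNr -(Rintegral_derive_C1c Cphi sltT) Rintegral_mkcond.
rewrite -RintegralZr//; last first.
  apply: (integrable_patchP leb _ _).1 => //.
  by have [_ c _] := Cphi; exact: continuous_integrable_itv.
apply: eq_Rintegral => t _; rewrite /P /w0 !patchE sI.
case: ifPn => [/set_mem/=|tT].
  rewrite in_itv/= => /andP[t0 tT].
  case: ifPn => st; first by rewrite mem_set//= in_itv/= st.
  by rewrite memNset ?mul0r ?mulr0//= in_itv/= (negbTE st).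
rewrite memNset ?mul0r//= in_itv/= => /andP[st tlt].
by move/negP : tT; apply; apply/mem_set; rewrite /= in_itv/= tlt (lt_trans s0).
Qed.

End primitive.

(** * Signs detected by bumps *)

Section variational.
Context {R : realType}.
Local Notation leb := (@lebesgue_measure R).
Variable T : R.
Implicit Types g : R -> R.

Let measurable_bump n a b : measurable_fun setT (@bump R n a b).
Proof.
apply: continuous_measurable_fun => t.
apply: differentiable_continuous; apply/derivable1_diffP.
by have [] := is_derive_bump n a b t.
Qed.

Lemma integrable_bumpM n a b g (D : set R) : measurable D ->
  leb.-integrable D (EFin \o g) ->
  leb.-integrable D (fun t => (bump n a b t * g t)%:E).
Proof.
move=> mD ig; have mg := measurable_int _ ig.
apply: le_integrable ig => //.
  apply/measurable_EFinP; apply: measurable_funM.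
    by apply: measurable_funTS; exact: measurable_bump.
  exact/measurable_EFinP.
move=> t _ /=; rewrite lee_fin normrM ler_piMl//.
by rewrite ger0_norm ?bump_ge0 ?bump_le1.
Qed.

(** The bumps stay below 1 and converge to the indicator of []a, b[], so [|g|] dominates the
    integrands. *)
Lemma Rintegral_itvoo_bump_le0 (a b : R) g : a < b ->
  leb.-integrable setT (EFin \o g) ->
  (forall n, \int[leb]_t (bump n a b t * g t) <= 0) ->
  \int[leb]_(t in `]a, b[) g t <= 0.
Proof.
move=> ab ig gle0.
have mg : measurable_fun setT g by apply/measurable_EFinP; exact: measurable_int _ ig.
pose f t := (if (a < t < b) then g t else 0)%:E.
have -> : \int[leb]_(t in `]a, b[) g t = fine (\int[leb]_t f t)%E.
  rewrite Rintegral_mkcond; apply: eq_Rintegral => t _.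
  by rewrite patchE mem_setE in_itv.
have mf : measurable_fun setT f.
  apply/measurable_EFinP; apply: measurable_fun_ifT => //.
  by apply: measurable_and; apply: measurable_fun_ltr.
have [| | | | |if_ _ cf] := @dominated_convergence _ _ R leb setT measurableT
  (fun n t => (bump n a b t * g t)%:E) f (fun t => `|g t|%:E).
- by move=> n; apply: measurable_int _ (integrable_bumpM n a b measurableT ig).
- exact: mf.
- apply: aeW => t _; rewrite /f /=; apply: cvg_EFin; first exact: nearW.
  have [tab|tab] := ifPn.
    rewrite -[X in _ --> X]mul1r; apply: cvgM; last exact: cvg_cst.
    exact: cvg_bump.
  rewrite (_ : (fun _ => _) = cst 0); first exact: cvg_cst.
  apply/funext => n /=; rewrite bump_eq0 ?mul0r//; first exact: ltW.
  exact/negP.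
- exact: integrable_norm.
- apply: aeW => t n _; rewrite lee_fin normrM ler_piMl//.
  by rewrite ger0_norm ?bump_ge0 ?bump_le1.
have ffin : (\int[leb]_t f t)%E \is a fin_num by exact: integrable_fin_num.
rewrite -lee_fin fineK//; apply: cvge_to_le cf _.
apply: nearW => n; have := gle0 n; rewrite -lee_fin fineK//.
by apply: integrable_fin_num => //; exact: integrable_bumpM.
Qed.

(* Only the countably many bumps with rational endpoints are tested, so that in
   the vector-valued case the exceptional null sets of the weak equation can be
   collected into one. *)
Lemma ae_le0_bump g : leb.-integrable `]0, T[ (EFin \o g) ->
  (forall (a b : rat) n, 0 < ratr a :> R -> ratr a < ratr b :> R ->
    ratr b < T -> \int[leb]_(t in `]0, T[) (bump n (ratr a) (ratr b) t * g t) <= 0) ->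
  {ae leb, forall t, 0 < t < T -> g t <= 0}.
Proof.
move=> ig hg; pose g0 := g \_ `]0, T[.
have ig0 : leb.-integrable setT (EFin \o g0).
  by apply: (integrable_patchP leb _ _).1.
(* The bump inequalities pass to intervals, so [G] is nonincreasing along the rationals of []0, T[];
   by Lebesgue differentiation its derivative is [g0] almost everywhere. *)
pose G x := \int[leb]_(t in `]-oo, x]) g0 t.
have iG y : leb.-integrable `]-oo, y] (EFin \o g0).
  exact: (@integrableS _ (measurableTypeR R) R leb setT).
have Gle (a b : rat) : 0 < ratr a :> R -> ratr a < ratr b :> R -> ratr b < T ->
    G (ratr b) <= G (ratr a).
  move=> a0 ab bT; rewrite -subr_le0 /G Rintegral_itvB//; last first.
    by rewrite bnd_simp ltW.
  rewrite -Rintegral_itv_bndo_bndc; last first.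
    exact: (@integrableS _ (measurableTypeR R) R leb setT).
  apply: Rintegral_itvoo_bump_le0 => // n.
  rewrite (_ : \int[leb]_t _ =
      \int[leb]_(t in `]0, T[) (bump n (ratr a) (ratr b) t * g t)).
    exact: hg.
  rewrite [RHS]Rintegral_mkcond; apply: eq_Rintegral => t _.
  by rewrite /g0 !patchE; case: ifP => // _; rewrite mulr0.
have lg0 : locally_integrable [set: R] g0 by exact: integrable_locally.
apply: ae_imply (FTC1Ny iG lg0) _ => x [dG Gx] /andP[x0 xT].
have g0x : g0 x = g x by rewrite /g0 patchE mem_set//= in_itv/= x0 xT.
(* A positive derivative at [x] would make the difference quotients positive near [x], so that
   rationals [q1 < x < q2] close to [x] satisfy [G q1 < G x < G q2], against [Gle]. *)
rewrite -g0x -Gx leNgt; apply/negP => Gx0.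
have : \forall h \near 0^', 0 < h^-1 *: (G (h *: 1 + x) - G x).
  move: Gx0; rewrite derive1E => Gx0.
  exact: (cvgr_gt _ dG).
move=> [e /= e0 he].
have q_gt0 h : h != 0 -> `|h| < e -> 0 < h^-1 * (G (h + x) - G x).
  move=> h0 hle; have := he h; rewrite /= sub0r normrN => /(_ hle h0).
  by rewrite -[h *: 1]/(h * 1) mulr1.
have [q1] : exists q, ratr q \in `](Num.max 0 (x - e)), x[.
  by apply: rat_in_itvoo; rewrite gt_max x0 ltrBlDr ltrDl.
have [q2] : exists q, ratr q \in `]x, (Num.min T (x + e))[.
  by apply: rat_in_itvoo; rewrite lt_min xT ltrDl.
rewrite !in_itv/= lt_min gt_max => /and3P[xq2 q2T q2e] /andP[/andP[q10 q1e] q1x].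
have h2 : G x < G (ratr q2).
  have := q_gt0 (ratr q2 - x); rewrite subrK pmulr_rgt0 ?invr_gt0 ?subr_gt0//.
  apply; first by rewrite subr_eq0 gt_eqF.
  by rewrite gtr0_norm ?subr_gt0// ltrBlDl.
have h1 : G (ratr q1) < G x.
  have := q_gt0 (ratr q1 - x); rewrite subrK nmulr_rgt0 ?invr_lt0 ?subr_lt0//.
  apply; first by rewrite subr_eq0 lt_eqF.
  by rewrite ltr0_norm ?subr_lt0// opprB ltrBlDl -ltrBlDr.
have := Gle q1 q2 q10 (lt_trans q1x xq2) q2T.
by rewrite leNgt (lt_trans h1 h2).
Qed.

Lemma ae_eq0_bump g : leb.-integrable `]0, T[ (EFin \o g) ->
  (forall (a b : rat) n, 0 < ratr a :> R -> ratr a < ratr b :> R ->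
    ratr b < T -> \int[leb]_(t in `]0, T[) (bump n (ratr a) (ratr b) t * g t) = 0) ->
  {ae leb, forall t, 0 < t < T -> g t = 0}.
Proof.
move=> ig hg.
have h1 : {ae leb, forall t, 0 < t < T -> g t <= 0}.
  by apply: ae_le0_bump => // a b n a0 ab bT; rewrite hg.
have h2 : {ae leb, forall t, 0 < t < T -> - g t <= 0}.
  apply: (@ae_le0_bump (fun t => - g t)).
    by move: (integrableN ig); apply: eq_integrable.
  move=> a b n a0 ab bT; under eq_Rintegral do rewrite mulrN -mulN1r.
  by rewrite RintegralZl// ?hg ?mulr0//; exact: integrable_bumpM.
apply: ae_imply2 h1 h2 _ => t g1 g2 tT; apply/eqP.
by rewrite eq_le g1//= -oppr_le0 g2.
Qed.

End variational.

(** * The du Bois-Reymond lemma and the structure of nonincreasing kernels *)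

Section du_bois_reymond.
Context {R : realType}.
Local Notation leb := (@lebesgue_measure R).
Variable T : R.
Hypothesis T0 : 0 < T.
Implicit Types (f g k w : R -> R).

Let integrable1 : leb.-integrable `]0, T[ (EFin \o cst 1).
Proof. by apply: continuous_integrable_itv => t; exact: cvg_cst. Qed.

Let bumpI n a b : leb.-integrable `]0, T[ (EFin \o bump n a b).
Proof.
have := integrable_bumpM n a b (measurable_itv _) integrable1.
by apply: eq_integrable => // t _ /=; rewrite mulr1.
Qed.

Lemma continuous_bump n a b : continuous (@bump R n a b).
Proof.
move=> t; apply: differentiable_continuous; apply/derivable1_diffP.
by have [] := is_derive_bump n a b t.
Qed.

Lemma ae_itv_neq0 : ~ {ae leb, forall t, 0 < t < T -> False}.
Proof.
move=> /negligibleP; apply: contraPP => _.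
rewrite (_ : ~` _ = `]0, T[%classic); last first.
  apply/seteqP; split=> t /=; rewrite in_itv/=.
    by move/existsNP => [h _].
  by move=> h; apply.
move=> /(_ (measurable_itv _)) /=; rewrite lebesgue_measure_itv/= lte_fin T0.
by rewrite oppr0 adde0 => -[] /eqP; rewrite gt_eqF.
Qed.

(** No integral of a bump is computed: if none were positive, [ae_le0_bump] applied to the constant
    1 would give [1 <= 0] almost everywhere on []0, T[]. *)
Lemma exists_bump_gt0 : exists a b n,
  [/\ 0 < a, a <= b, b < T & 0 < \int[leb]_(t in `]0, T[) @bump R n a b t].
Proof.
apply: contrapT => nex.
have := @ae_le0_bump R T (cst 1) integrable1.
have h (a b : rat) n : 0 < ratr a :> R -> ratr a < ratr b :> R -> ratr b < T ->
    \int[leb]_(t in `]0, T[) (bump n (ratr a) (ratr b) t * cst 1 t) <= 0.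
  move=> a0 ab bT; rewrite leNgt; apply/negP => pos; apply: nex.
  exists (ratr a), (ratr b), n; split => //; first exact: ltW.
  apply: (lt_le_trans pos); rewrite le_eqVlt; apply/orP; left; apply/eqP.
  by apply: eq_Rintegral => t _; rewrite mulr1.
move=> /(_ h) H; apply: ae_itv_neq0.
by apply: ae_imply H _ => t /[apply]; rewrite /= ler10.
Qed.

Let bump_patch n a b : 0 < a -> a <= b -> b < T ->
  (bump n a b) \_ `]0, T[ = bump n a b.
Proof.
move=> a0 ab bT; apply/funext => t; rewrite patchE; case: ifPn => //.
rewrite notin_setE/= in_itv/= => tI; rewrite bump_eq0// => /andP[at_ tb].
by apply: tI; rewrite (lt_trans a0)// (lt_trans tb).
Qed.

(** Source of test functions: a continuous function of integral 0, supported in a compact part of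
    []0, T[], has a primitive that vanishes to the left of the support and, the total being 0, also
    to the right. *)
Lemma C1c_primitive_bumpB n a b m c d (l : R) :
  0 < a -> a <= b -> b < T -> 0 < c -> c <= d -> d < T ->
  \int[leb]_(t in `]0, T[) bump n a b t =
    l * \int[leb]_(t in `]0, T[) bump m c d t ->
  exists2 phi, C1c T phi & derive1 phi = fun t => bump n a b t - l * bump m c d t.
Proof.
move=> a0 ab bT c0 cd dT eI.
pose rho t : R := bump n a b t - l * bump m c d t.
have crho : continuous rho.
  move=> t; apply: cvgB; first exact: continuous_bump.
  by apply: cvgM; [exact: cvg_cst|exact: continuous_bump].
have irho : leb.-integrable `]0, T[ (EFin \o rho) by exact: continuous_integrable_itv.
have rhoT : rho \_ `]0, T[ = rho.
  rewrite -{2}/rho; apply/funext => t; rewrite patchE; case: ifPn => // tI.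
  rewrite /rho -(bump_patch n a0 ab bT) -(bump_patch m c0 cd dT) !patchE.
  by rewrite (negbTE tI) mulr0 subr0.
have irhoT : leb.-integrable setT (EFin \o rho).
  by rewrite -rhoT; apply: (integrable_patchP leb _ _).1.
have irhoS D : measurable D -> leb.-integrable D (EFin \o rho).
  by move=> mD; exact: (@integrableS _ (measurableTypeR R) R leb setT).
pose phi x := \int[leb]_(t in `]-oo, x]) rho t.
have dphi x : derivable phi x 1 /\ (derive1 phi) x = rho x.
  apply: (@continuous_FTC1 _ _ _ x (x + 1)) => //.
  - by rewrite ltrDl.
  - exact: irhoS.
  - by rewrite ltNyr.
  - exact: crho.
have rho0 t : ~ (Num.min a c <= t <= Num.max b d) -> rho t = 0.
  move=> h; rewrite /rho !bump_eq0 ?mulr0 ?subr0// => /andP[h1 h2]; apply: h;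
  by rewrite ge_min le_max (ltW h1) (ltW h2) ?orbT.
have rint0 : \int[leb]_t rho t = 0.
  rewrite -rhoT -Rintegral_mkcond RintegralB//; last first.
    by apply: integrableZlR => //; exact: bumpI.
  by rewrite RintegralZl// eI subrr.
exists phi; last by apply/funext => t; have [] := dphi t.
split.
- by move=> t; have [] := dphi t.
- by rewrite (_ : derive1 phi = rho)//; apply/funext => t; have [] := dphi t.
exists (Num.min a c), (Num.max b d); split.
- by rewrite lt_min a0 c0.
- by rewrite gt_max bT dT.
move=> t; apply: contraNT => tI; apply/eqP.
have [ta|ta] := ltP t (Num.min a c).
  rewrite /phi -[RHS](mul0r (fine (leb `]-oo, t]))) -Rintegral_cst//.
  apply: eq_Rintegral => s; rewrite inE/= in_itv/= => st; apply: rho0.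
  by move=> /andP[s1 _]; move: ta; rewrite ltNge (le_trans s1 st).
have bt : Num.max b d < t by rewrite ltNge; apply: contra tI => ->; rewrite ta.
rewrite -rint0 /phi Rintegral_mkcond; apply: eq_Rintegral => s _.
rewrite patchE; case: ifPn => //; rewrite notin_setE/= in_itv/= => /negP.
rewrite -ltNge => ts; rewrite rho0// => /andP[_ sb].
by have := lt_trans (le_lt_trans sb bt) ts; rewrite ltxx.
Qed.

(** The constant is the mean [l] of [f] weighted by one fixed bump of integral [J > 0]. Subtracting
    from a bump [B] the multiple [s] of the fixed one that has the same integral leaves the
    derivative of a test function. Testing with it shows that the integral of [B f] is [l] times
    that of [B], so [f - l] annihilates every rational bump. *)
Lemma du_bois_reymond f : leb.-integrable `]0, T[ (EFin \o f) ->
  (forall phi, C1c T phi -> \int[leb]_(t in `]0, T[) (derive1 phi t * f t) = 0) ->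
  exists c, {ae leb, forall t, 0 < t < T -> f t = c}.
Proof.
move=> if_ f0; have [c [d [m [c0 cd dT Ipos]]]] := exists_bump_gt0.
set J := \int[leb]_(t in _) _ in Ipos.
pose l := (\int[leb]_(t in `]0, T[) (bump m c d t * f t)) / J.
exists l.
have ig : leb.-integrable `]0, T[ (EFin \o (fun t => f t - l)).
  have il : leb.-integrable `]0, T[ (EFin \o cst l).
    by apply: continuous_integrable_itv => t; exact: cvg_cst.
  have := fun m => integrableB m if_ il; move=> /(_ (measurable_itv _)).
  by apply: eq_integrable => // t _ /=; rewrite EFinB.
suff : {ae leb, forall t, 0 < t < T -> f t - l = 0}.
  by move=> H; apply: ae_imply H _ => t /[apply] /eqP; rewrite subr_eq0 => /eqP.
apply: (@ae_eq0_bump R T (fun t => f t - l)) => // a b n a0 ab bT.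
set B := bump n _ _.
have iBf : leb.-integrable `]0, T[ (fun t => (B t * f t)%:E).
  exact: integrable_bumpM.
have imf : leb.-integrable `]0, T[ (fun t => (bump m c d t * f t)%:E).
  exact: integrable_bumpM.
pose s := (\int[leb]_(t in `]0, T[) B t) / J.
have [|phi Cphi dphi] := @C1c_primitive_bumpB n _ _ m c d s a0 (ltW ab) bT c0 cd dT.
  by rewrite -/J /s mulfVK// gt_eqF.
have := f0 _ Cphi; rewrite dphi.
rewrite (_ : \int[leb]_(t in _) _ =
  \int[leb]_(t in `]0, T[) (B t * f t - s * (bump m c d t * f t))); last first.
  by apply: eq_Rintegral => t _; rewrite -/B; ring.
have ismf : leb.-integrable `]0, T[ (fun t => (s * (bump m c d t * f t))%:E).
  exact: integrableZlR.
rewrite RintegralB// RintegralZl// => /eqP; rewrite subr_eq0 => /eqP eBf.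
have iBl : leb.-integrable `]0, T[ (fun t => (B t * l)%:E).
  by apply: integrableZrR => //; exact: bumpI.
under eq_Rintegral do rewrite mulrBr.
rewrite RintegralB// eBf RintegralZr//; last exact: bumpI.
by rewrite /s /l; field; rewrite gt_eqF.
Qed.

(** Up to the midpoint [m] of a bump [phi], [phi' >= 0] and [k >= k m]; beyond it both signs turn.
    Hence [phi' k >= phi' (k m)] throughout, and the right side has integral 0. *)
Lemma weak_derivative_nonincreasing k w : weak_derivative T k w ->
  (forall s t, 0 < s -> s <= t -> t < T -> k t <= k s) ->
  {ae leb, forall t, 0 < t < T -> w t <= 0}.
Proof.
move=> [ik iw kw] kmono; apply: ae_le0_bump => // a b n a0 ab bT.
set a' := ratr a in a0 ab *; set b' := ratr b in ab bT *.
have Cb : C1c T (bump n a' b') by apply: C1c_bump => //; exact: ltW.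
rewrite -[leLHS]opprK -kw// oppr_le0.
have ib := C1c_integrable_derive Cb.
pose m := (a' + b') / 2.
have m0 : 0 < m by rewrite divr_gt0// addr_gt0// (lt_trans a0).
have mT : m < T by rewrite /m; lra.
have ibm : leb.-integrable `]0, T[ (fun t => (derive1 (bump n a' b') t * k m)%:E).
  exact: integrableZrR.
have e0 : \int[leb]_(t in `]0, T[) (derive1 (bump n a' b') t * k m) = 0.
  by rewrite RintegralZr// Rintegral_derive_C1c0// mul0r.
rewrite derive1_bump in ib ibm e0 *; rewrite -[leLHS]e0.
have ibk : leb.-integrable `]0, T[ (fun t => (bump_derive n a' b' t * k t)%:E).
  by apply: integrable_continuousM => //; exact: continuous_bump_derive.
apply: le_Rintegral => // t; rewrite /= in_itv/= => /andP[t0 tT].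
have [tm|tm] := leP t m.
  by rewrite ler_wpM2l ?bump_derive_ge0// kmono.
by apply: ler_wnM2l; [exact/bump_derive_le0/ltW|apply: kmono => //; exact: ltW].
Qed.

Lemma W11_nonincreasing k : W11 T k ->
  (forall s t, 0 < s -> s <= t -> t < T -> k t <= k s) ->
  exists c w, [/\ leb.-integrable setT (EFin \o w), forall t, w t <= 0,
    forall t, ~ (0 < t < T) -> w t = 0 &
    {ae leb, forall t, 0 < t < T -> k t = c + primitive w t}].
Proof.
move=> [w0 kw0] kmono; have [ik iw0 hk] := kw0.
have w0le := weak_derivative_nonincreasing kw0 kmono.
have [ip _ hp] := weak_derivative_primitive iw0 T0.
(* The truncation makes the sign hold everywhere and confines the support to []0, T[]. Inside []0,
   T[] it alters [w0] on a null set only, which [primitive] does not see. *)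
pose w t := if 0 < t < T then Num.min (w0 t) 0 else 0.
have [c hc] : exists c, {ae leb, forall t, 0 < t < T -> k t - primitive w0 t = c}.
  apply: du_bois_reymond => [|phi Cphi].
    have := fun m => integrableB m ik ip; move=> /(_ (measurable_itv _)).
    by apply: eq_integrable => // t _ /=; rewrite EFinB.
  have [_ cphi _] := Cphi.
  under eq_Rintegral do rewrite mulrBr.
  by rewrite RintegralB ?hk ?hp ?subrr//; exact: integrable_continuousM.
have mw0 : measurable_fun `]0, T[ w0 by apply/measurable_EFinP; exact: measurable_int _ iw0.
have wE : w = (fun t => Num.min (w0 t) 0) \_ `]0, T[.
  by apply/funext => t; rewrite patchE mem_setE in_itv.
have iw : leb.-integrable setT (EFin \o w).
  rewrite wE; apply: (integrable_patchP leb _ _).1 => //.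
  apply: le_integrable iw0 => //.
    apply/measurable_EFinP; exact: measurable_minr.
  move=> t _ /=; rewrite lee_fin; have [//|?] := leP (w0 t) 0.
  by rewrite normr0.
exists c, w; split=> //.
- by move=> t; rewrite /w; case: ifP => // _; rewrite ge_min lexx orbT.
- by move=> t /negP/negbTE h; rewrite /w h.
apply: ae_imply hc _ => t h tT; rewrite -(h tT) -[LHS](subrK (primitive w0 t)).
congr (_ + _); rewrite /primitive /Rintegral; congr fine.
have sub : `]0, t[ `<=` `]0, T[.
  by apply: subset_itvl; rewrite bnd_simp ltW//; case/andP: tT.
apply: ae_eq_integral => //.
- by apply/measurable_EFinP; apply: measurable_funS mw0.
- by apply: measurable_funTS; exact: measurable_int _ iw.
apply: ae_imply w0le _ => s ws /= /sub /=; rewrite in_itv/= => sT.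
by rewrite /w sT min_l// ws.
Qed.

End du_bois_reymond.

(** * Convolution on the line and its weak derivative *)

Section line_convolution.
Context {R : realType}.
Local Notation leb := (@lebesgue_measure R).
Implicit Types (T t s c : R) (f g k v w : R -> R).

Definition line_conv f g t := \int[leb]_s (f (t - s) * g s).

(** For [0 < s < t <= T] both [s] and [t - s] lie in []0, T[]; for [s <= 0] or [s >= t] one of the
    two extensions vanishes. The endpoints of [[0, t]] form a null set. *)
Lemma convE T k v t : measurable_fun `]0, T[ k -> measurable_fun `]0, T[ v ->
  0 <= t <= T -> conv k v t = line_conv (k \_ `]0, T[) (v \_ `]0, T[) t.
Proof.
move=> mk mv /andP[t0 tT].
have mk0 : measurable_fun setT (k \_ `]0, T[) by apply: (measurable_restrictT _ _).1.
have mv0 : measurable_fun setT (v \_ `]0, T[) by apply: (measurable_restrictT _ _).1.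
pose g s := (k \_ `]0, T[) (t - s) * (v \_ `]0, T[) s.
have mg : measurable_fun setT g.
  apply: measurable_funM => //; apply: (measurableT_comp mk0).
  exact: measurable_reflect.
have gE s : 0 < s < t -> g s = k (t - s) * v s.
  move=> /andP[s0 st]; rewrite /g !patchE !mem_set//= in_itv/=.
    by rewrite s0 (lt_le_trans st).
  by rewrite subr_gt0 st/= ltrBlDr (le_lt_trans tT)// ltrDl.
rewrite /conv /line_conv /Rintegral; congr fine.
rewrite (@integral_itv_bndoo _ 0 t _ true false); last first.
  have : measurable_fun `]0, t[ (EFin \o g).
    by apply/measurable_EFinP; exact: measurable_funTS.
  apply: eq_measurable_fun => s; rewrite inE/= in_itv/= => st.
  by rewrite gE.
rewrite [LHS]integral_mkcond.
apply: eq_integral => s _; rewrite patchE.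
case: ifPn => [|]; first by rewrite inE/= in_itv/= => /gE <-.
rewrite notin_setE/= in_itv/= => /negP st; congr EFin; rewrite !patchE.
case: ifPn; last by rewrite mul0r.
rewrite inE/= in_itv/= subr_gt0 => /andP[st' _].
case: ifPn; last by rewrite mulr0.
by rewrite inE/= in_itv/= => /andP[s0 _]; move: st; rewrite s0 st'.
Qed.

Section weak_derivative_conv.
Variables (T c : R) (k w v : R -> R).
Hypothesis T0 : 0 < T.
Hypothesis mk : measurable_fun `]0, T[ k.
Hypothesis iw : leb.-integrable setT (EFin \o w).
Hypothesis w0 : forall t, ~ (0 < t < T) -> w t = 0.
Hypothesis kE : {ae leb, forall t, 0 < t < T -> k t = c + primitive w t}.
Hypothesis iv : leb.-integrable `]0, T[ (EFin \o v).

Let V := v \_ `]0, T[.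
Let D t := c * V t + line_conv w V t.

Let iV : leb.-integrable setT (EFin \o V).
Proof. by apply: (integrable_patchP leb _ _).1. Qed.

Let VE s : ~ (0 < s < T) -> V s = 0.
Proof.
by move=> sT; rewrite /V patchE; case: ifPn => //; rewrite inE/= in_itv/= => /sT.
Qed.

Let iC : leb.-integrable setT (EFin \o line_conv w V).
Proof. exact: (integrable_Rintegral2 (integrable_conv iw iV)). Qed.

Let iD : leb.-integrable setT (EFin \o D).
Proof.
have icV := integrableZlR measurableT c iV.
have := fun m => integrableD m icV iC; move=> /(_ measurableT).
by apply: eq_integrable => // t _ /=; rewrite EFinD.
Qed.

Let iS (A : set (measurableTypeR R)) f : measurable A ->
  leb.-integrable setT (EFin \o f) -> leb.-integrable A (EFin \o f).
Proof. by move=> mA; exact: (@integrableS _ (measurableTypeR R) R leb setT). Qed.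

(** Its two iterated integrals are, at time [t], the primitive of the convolution of [w] with [V]
    and the convolution of [primitive w] with [V]. *)
Let Ft t (z : measurableTypeR R * measurableTypeR R) : R :=
  \1_(`]0, t[%classic : set R) z.1 * (w (z.1 - z.2) * V z.2).

Let iF t : (leb \x leb)%E.-integrable setT (EFin \o Ft t).
Proof.
have ic := integrable_conv iw iV.
apply: (le_integrable _ _ _ ic) => //.
  apply/measurable_EFinP; apply: measurable_funM.
    apply: (measurableT_comp _ (@measurable_fst _ _ _ _)).
    exact: measurable_indic.
  by apply/measurable_EFinP; exact: measurable_int _ ic.
move=> z _ /=; rewrite lee_fin /Ft normrM ler_piMl//.
by rewrite indicE normr_nat; case: (_ \in _).
Qed.

(** The kernel vanishes for [r <= s], as [w] lives on []0, T[]; for [r > s > 0] the condition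
    [0 < r < t] becomes [0 < r - s < t - s], which is handled by a translation. *)
Let FtE t s : \int[leb]_r Ft t (r, s) = primitive w (t - s) * V s.
Proof.
have [sT|/negP/VE Vs] := boolP (0 < s < T); last first.
  rewrite Vs mulr0 -[RHS](mul0r (fine (leb setT))) -Rintegral_cst//.
  by apply: eq_Rintegral => r _; rewrite /Ft/= Vs !mulr0.
have iw' : leb.-integrable `]0, (t - s)[ (EFin \o w) by exact: iS.
rewrite /primitive -RintegralZr// [RHS]Rintegral_mkcond /Rintegral; congr fine.
pose h r := ((fun x => w x * V s) \_ `]0, (t - s)[) r.
have mh : measurable_fun setT (EFin \o h).
  apply/measurable_EFinP; apply: (measurable_restrictT _ _).1 => //.
  by apply: measurable_funM => //; apply/measurable_EFinP; exact: measurable_int _ iw'.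
rewrite -(integral_shift s mh); apply: eq_integral => r _; congr EFin.
rewrite /Ft /h/= patchE indicE.
have [/andP[s0 _]] := (sT, I).
have [rs|rs] := leP r s.
  rewrite w0 ?mul0r ?mulr0; last by rewrite subr_gt0 ltNge rs.
  by case: ifP => // _; rewrite w0 ?mul0r// subr_gt0 ltNge rs.
have -> : (r - s \in `]0, (t - s)[%classic) = (r \in `]0, t[%classic).
  by rewrite !mem_setE !in_itv/= subr_gt0 rs ltrD2r (lt_trans s0 rs).
by case: ifP => _; rewrite ?mul1r ?mul0r.
Qed.

(** A representative given by a formula at every point; [kE] ties it to [k] only up to a null set,
    which a convolution does not see. *)
Let kk t := if 0 < t < T then c + primitive w t else 0.

Let mkk : measurable_fun setT kk.
Proof.
have mp : measurable_fun `]0, T[ (primitive w).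
  have [ip _ _] := weak_derivative_primitive (iS (measurable_itv `]0, T[) iw) T0.
  by apply/measurable_EFinP; exact: measurable_int _ ip.
rewrite (_ : kk = (fun t => c + primitive w t) \_ `]0, T[).
  by apply: (measurable_restrictT _ _).1 => //; exact: measurable_funD.
by apply/funext => t; rewrite /kk patchE mem_setE in_itv.
Qed.

Let mk0 : measurable_fun setT (k \_ `]0, T[).
Proof. by apply: (measurable_restrictT _ _).1. Qed.

Let mV : measurable_fun setT V.
Proof. by apply/measurable_EFinP; exact: measurable_int _ iV. Qed.

Let conv_kk t : 0 < t < T -> conv k v t = \int[leb]_s (kk (t - s) * V s).
Proof.
move=> /andP[t0 tT]; rewrite (@convE T)//; last 2 first.
  by apply/measurable_EFinP; exact: measurable_int _ iv.
  by rewrite !ltW.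
rewrite /line_conv /Rintegral; congr fine.
have mr f : measurable_fun setT f -> measurable_fun setT (fun s => (f (t - s) * V s)%:E).
  move=> mf; apply/measurable_EFinP; apply: measurable_funM => //.
  by apply: (measurableT_comp mf); exact: measurable_reflect.
apply: ae_eq_integral => //; [exact: mr|exact: mr|].
have : (fun r => (k \_ `]0, T[) r - kk r) = cst 0 %[ae leb].
  apply: ae_imply kE _ => r hr _; rewrite /= patchE /kk mem_setE in_itv/=.
  by case: ifP => [/hr ->|_]; rewrite subrr.
move=> /(ae_reflect t (measurable_funB mk0 mkk)) H.
apply: ae_imply H _ => s /(_ I) /= /eqP; rewrite subr_eq0 => /eqP ks _.
by rewrite ks.
Qed.

(** Convolving commutes with integrating from 0, so [k * v] is itself a primitive, at every [t] of
    the interval, and [weak_derivative_primitive] differentiates it. *)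
Lemma conv_primitive t : 0 < t < T -> conv k v t = primitive D t.
Proof.
move=> tT; rewrite conv_kk//; have /andP[t0 tltT] := tT.
have iVt : leb.-integrable setT (EFin \o (V \_ `]0, t[)).
  by apply: (integrable_patchP leb _ _).1 => //; exact: iS.
have iPV : leb.-integrable setT (EFin \o (fun s => primitive w (t - s) * V s)).
  have := integrable_Rintegral2 (integrable_swap (iF t)).
  by apply: eq_integrable => // s _ /=; rewrite FtE.
transitivity (\int[leb]_s (c * (V \_ `]0, t[) s + primitive w (t - s) * V s)).
  apply: eq_Rintegral => s _; rewrite /kk patchE mem_setE in_itv/=.
  have [sT|/negP/VE ->] := boolP (0 < s < T); last first.
    by rewrite !mulr0; case: ifP; rewrite mulr0 addr0.
  have /andP[s0 _] := sT; rewrite s0/=.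
  have -> : (0 < t - s < T) = (s < t).
    by rewrite subr_gt0 ltrBlDr (lt_trans tltT) ?ltrDl// andbT.
  case: ifPn => st; first by rewrite mulrDl.
  (* For [s >= t] the primitive runs over an empty interval and is 0, in agreement with [kk]. *)
  rewrite mulr0 mul0r add0r /primitive set_itv_ge ?Rintegral_set0 ?mul0r//.
  by rewrite bnd_simp subr_gt0.
rewrite RintegralD//; last exact: integrableZlR.
rewrite RintegralZl// -Rintegral_mkcond /primitive /D.
rewrite RintegralD//; [|by apply: iS => //; exact: integrableZlR|exact: iS].
rewrite RintegralZl//; last exact: iS.
congr (_ + _); transitivity (\int[leb]_s \int[leb]_r Ft t (r, s)).
  by apply: eq_Rintegral => s _; rewrite FtE.
rewrite -(Rintegral_fubini (iF t)) [RHS]Rintegral_mkcond.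
apply: eq_Rintegral => r _; rewrite patchE /Ft/= indicE /line_conv.
case: ifPn => _; first by apply: eq_Rintegral => s _; rewrite mul1r.
rewrite -[RHS](mul0r (fine (leb setT))) -Rintegral_cst//.
by apply: eq_Rintegral => s _; rewrite mul0r.
Qed.

Lemma weak_derivative_conv : weak_derivative T (conv k v) D.
Proof.
have [ip iD' hp] := weak_derivative_primitive (iS (measurable_itv `]0, T[) iD) T0.
split => //.
  move: ip; apply: eq_integrable => // t; rewrite inE/= in_itv/= => tT.
  by rewrite conv_primitive.
move=> phi Cphi; rewrite -hp//; apply: eq_Rintegral => t.
by rewrite inE/= in_itv/= => tT; rewrite conv_primitive.
Qed.

End weak_derivative_conv.

End line_convolution.

(** * Inequalities for powers and a weighted Hoelder inequality *)

Section poweR_supplement.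
Local Open Scope ereal_scope.
Context {R : realType}.
Implicit Types (x y : \bar R) (p : R).

Lemma ge0_le_poweR p x y : (0 <= p)%R -> 0 <= x -> x <= y -> x `^ p <= y `^ p.
Proof.
move=> p0 x0 xy; apply: gt0_ler_poweR => //.
  by rewrite in_itv/= x0 leey.
by rewrite in_itv/= (le_trans x0)//= leey.
Qed.

(** Gives the embedding of L_p into L_1 over a bounded time interval, in place of Hoelder's
    inequality in time. *)
Lemma le_1DpoweR p x : (1 <= p)%R -> 0 <= x -> x <= 1 + x `^ p.
Proof.
move=> p1; have p0 : (0 < p)%R by exact: lt_le_trans p1.
case: x => [r| |]//=; last by rewrite gt_eqF.
rewrite lee_fin => r0; rewrite -EFinD lee_fin; have [r1|r1] := leP r 1%R.
  by rewrite (le_trans r1)// lerDl powR_ge0.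
by rewrite (le_trans (le1r_powR (ltW r1) p1))// lerDr.
Qed.

(** The factor [2 ^ p] comes from [|a + b| <= 2 max(|a|, |b|)]. *)
Lemma powR_addr_le p (a b : R) : (0 <= p)%R ->
  (`|a + b| `^ p <= 2 `^ p * (`|a| `^ p + `|b| `^ p))%R.
Proof.
move=> p0; pose m : R := Num.max `|a|%R `|b|%R.
have m0 : (0 <= m)%R by rewrite le_max normr_ge0.
have abm : (`|a + b| <= 2 * m)%R.
  rewrite (le_trans (ler_normD _ _))// mulr2n mulrDl mul1r lerD//.
    by rewrite le_max lexx.
  by rewrite le_max lexx orbT.
apply: (@le_trans _ _ ((2 * m) `^ p)%R).
  by apply: ge0_ler_powR; rewrite ?nnegrE// mulr_ge0.
rewrite powRM// ler_wpM2l ?powR_ge0// /m.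
by have [?|?] := leP `|a|%R `|b|%R; rewrite ?lerDl ?lerDr powR_ge0.
Qed.

End poweR_supplement.

Section weighted_hoelder.
Local Open Scope ereal_scope.
Context d (Y : measurableType d) (R : realType) (nu : {measure set Y -> \bar R}).
Variables (p q : R).
Hypotheses (p0 : (0 < p)%R) (q0 : (0 < q)%R) (pq : (p^-1 + q^-1 = 1)%R).

(** Hoelder for the splitting [a b = a^(1/q) (a^(1/p) b)]. With [a] the modulus of the kernel, this
    is the pointwise step of Young's inequality. *)
Lemma weighted_hoelder (a b : Y -> R) :
  measurable_fun setT a -> measurable_fun setT b ->
  (forall y, 0 <= a y)%R -> (forall y, 0 <= b y)%R ->
  (\int[nu]_y (a y * b y)%:E) `^ p <=
  (\int[nu]_y (a y)%:E) `^ (q^-1 * p) * \int[nu]_y (a y * b y `^ p)%:E.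
Proof.
move=> ma mb a0 b0.
pose f y := (a y `^ q^-1)%R; pose g y := (a y `^ p^-1 * b y)%R.
have mf : measurable_fun setT f by exact: (measurableT_comp (measurable_powR _)).
have mg : measurable_fun setT g.
  by apply: measurable_funM => //; exact: (measurableT_comp (measurable_powR _)).
have H : 'N[nu]_1[EFin \o (g \* f)%R] <= 'N[nu]_p%:E[EFin \o g] * 'N[nu]_q%:E[EFin \o f].
  exact: hoelder.
have {}H := ge0_le_poweR (ltW p0) (Lnorm_ge0 _ _ _) H.
rewrite poweRM ?Lnorm_ge0// poweR_Lnorm ?gt_eqF// Lnorm1 in H.
have -> : \int[nu]_y (a y * b y)%:E = \int[nu]_y `|(EFin \o (g \* f)%R) y|.
  apply: eq_integral => y _ /=; rewrite ger0_norm.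
    rewrite /g /f mulrAC -powRD ?pq ?powRr1//.
    by rewrite oner_eq0.
  by rewrite /g /f !mulr_ge0 ?powR_ge0.
apply: (le_trans H); rewrite muleC.
have -> : 'N[nu]_q%:E[EFin \o f] `^ p = (\int[nu]_y (a y)%:E) `^ (q^-1 * p).
  rewrite unlock -poweRrM; congr (_ `^ _); apply: eq_integral => y _ /=.
  by rewrite ger0_norm ?powR_ge0// /f -powRrM mulVf ?gt_eqF// powRr1.
rewrite le_eqVlt; apply/orP; left; apply/eqP; congr (_ * _).
apply: eq_integral => y _ /=; rewrite ger0_norm ?mulr_ge0 ?powR_ge0//.
by rewrite /g powRM ?powR_ge0// -powRrM mulVf ?gt_eqF// powRr1.
Qed.

End weighted_hoelder.

(** * The space of p-integrable functions of time and space *)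

Section Lp_time_space.
Local Open Scope ereal_scope.
Context d (X : measurableType d) (R : realType).
Variable mu : {sigma_finite_measure set X -> \bar R}.
Local Notation leb := (@lebesgue_measure R).
Local Notation TX := (measurableTypeR R * X)%type.
Variable p : R.
Hypothesis p1 : (1 < p)%R.
Implicit Types F G : TX -> R.

Let p0 : (0 < p)%R. Proof. exact: lt_trans p1. Qed.

(** The [p]-th power of the norm of L_p in time with values in L_p in space; the root is left out
    because only finiteness is at stake. *)
Definition Lpint F := \int[leb]_t \int[mu]_x (`|F (t, x)| `^ p)%:E.

Let mpow F : measurable_fun setT F ->
  measurable_fun setT (fun z => (`|F z| `^ p)%:E).
Proof.
move=> mF; apply/measurable_EFinP.
by apply: (measurableT_comp (measurable_powR _)); exact: measurableT_comp.
Qed.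

Let mslice F t : measurable_fun setT F -> measurable_fun setT (fun x => F (t, x)).
Proof. by move=> mF; apply: measurableT_comp => //; exact: measurable_pair1. Qed.

Let mint F : measurable_fun setT F ->
  measurable_fun setT (fun t => \int[mu]_x (`|F (t, x)| `^ p)%:E).
Proof.
by move=> mF; apply: (measurable_fun_integral2 mu (mpow mF)).
Qed.

Let mpow1 F t : measurable_fun setT F ->
  measurable_fun setT (fun x => (`|F (t, x)| `^ p)%:E).
Proof.
move=> mF; apply/measurable_EFinP; apply: (measurableT_comp (measurable_powR _)).
by apply: measurableT_comp => //; exact: mslice.
Qed.

Lemma le_Lpint F G : measurable_fun setT F -> measurable_fun setT G ->
  (forall z, `|F z| <= `|G z|)%R -> Lpint F <= Lpint G.
Proof.
move=> mF mG FG; apply: ge0_le_integral => //.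
- by move=> t _; apply: integral_ge0 => x _; rewrite lee_fin powR_ge0.
- exact: mint.
- exact: mint.
move=> t _; apply: ge0_le_integral => //.
- exact: mpow1.
- exact: mpow1.
- by move=> x _; rewrite lee_fin; apply: ge0_ler_powR; rewrite ?nnegrE//; exact: ltW.
Qed.

Lemma Lpint_ZlD_lty (c : R) F G : measurable_fun setT F -> measurable_fun setT G ->
  Lpint F < +oo -> Lpint G < +oo -> Lpint (fun z => c * F z + G z)%R < +oo.
Proof.
move=> mF mG Foo Goo.
pose A := ((2 `^ p * `|c| `^ p)%:E * Lpint F + (2 `^ p)%:E * Lpint G).
have Aoo : A < +oo.
  rewrite /A; apply: lte_add_pinfty.
    by apply: lte_mul_pinfty Foo; rewrite // lee_fin mulr_ge0 ?powR_ge0.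
  by apply: lte_mul_pinfty Goo; rewrite // lee_fin powR_ge0.
apply: le_lt_trans Aoo; rewrite /A /Lpint.
have ge0 H t : 0 <= \int[mu]_x (`|H (t, x)| `^ p)%:E.
  by apply: integral_ge0 => x _; rewrite lee_fin powR_ge0.
rewrite -!ge0_integralZl ?lee_fin ?mulr_ge0 ?powR_ge0//; [|exact: mint|exact: mint].
rewrite -ge0_integralD//; last 4 first.
- by move=> t _; rewrite mule_ge0// lee_fin mulr_ge0 ?powR_ge0.
- by apply: measurable_funeM; exact: mint.
- by move=> t _; rewrite mule_ge0// lee_fin powR_ge0.
- by apply: measurable_funeM; exact: mint.
apply: ge0_le_integral => //.
- by move=> t _; apply: integral_ge0 => x _; rewrite lee_fin powR_ge0.
- apply: (mint (F := fun z => (c * F z + G z)%R)).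
  by apply: measurable_funD => //; exact: measurable_funM.
- by apply: emeasurable_funD; apply: measurable_funeM; exact: mint.
move=> t _; rewrite -!ge0_integralZl ?lee_fin ?mulr_ge0 ?powR_ge0//; last 2 first.
- exact: mpow1.
- exact: mpow1.
rewrite -ge0_integralD//; last 2 first.
- by apply: measurable_funeM; exact: mpow1.
- by apply: measurable_funeM; exact: mpow1.
apply: ge0_le_integral => //.
- apply: (mpow1 (F := fun z => (c * F z + G z)%R)).
  by apply: measurable_funD => //; exact: measurable_funM.
- by apply: emeasurable_funD; apply: measurable_funeM; exact: mpow1.
move=> x _; rewrite -!EFinM -EFinD lee_fin (le_trans (powR_addr_le _ _ (ltW p0)))//.
by rewrite normrM powRM// mulrDr mulrA.
Qed.

End Lp_time_space.

(** * Young's inequality for convolution in time *)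

Section young.
Local Open Scope ereal_scope.
Context d (X : measurableType d) (R : realType).
Variable mu : {sigma_finite_measure set X -> \bar R}.
Local Notation leb := (@lebesgue_measure R).
Local Notation TX := (measurableTypeR R * X)%type.

Definition time_conv (w : R -> R) (U : TX -> R) (z : TX) : R :=
  line_conv w (fun s => U (s, z.2)) z.1.

Lemma measurable_time_conv w U : measurable_fun setT w -> measurable_fun setT U ->
  measurable_fun setT (time_conv w U).
Proof.
move=> mw mU.
apply: (measurable_fun_Rintegral2 leb
  (f := fun y : TX * measurableTypeR R => (w (y.1.1 - y.2) * U (y.2, y.1.2))%R)).
apply: measurable_funM.
  apply: (measurableT_comp mw); apply: measurable_funB => //.
  by apply: measurableT_comp.
apply: (measurableT_comp mU); apply: measurable_fun_pair => //.
by apply: measurableT_comp.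
Qed.

Lemma ge0_integral_conv (a : R -> R) (N : R -> \bar R) : measurable_fun setT a ->
  measurable_fun setT N -> (forall s, 0 <= a s)%R -> (forall s, 0 <= N s) ->
  \int[leb]_t \int[leb]_s ((a (t - s)%R)%:E * N s) =
  (\int[leb]_s (a s)%:E) * \int[leb]_s N s.
Proof.
move=> ma mN a0 N0.
have mf : measurable_fun setT (fun z : measurableTypeR R * measurableTypeR R =>
    (a (z.1 - z.2)%R)%:E * N z.2).
  apply: emeasurable_funM; last by apply: measurableT_comp.
  by apply/measurable_EFinP; apply: (measurableT_comp ma); apply: measurable_funB.
have fT := @fubini_tonelli _ _ _ _ R leb leb _ mf.
transitivity (\int[leb]_s \int[leb]_t ((a (t - s)%R)%:E * N s)).
  by apply: fT => z; apply: mule_ge0; [rewrite lee_fin; exact: a0|exact: N0].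
have ma1 : measurable_fun setT (EFin \o a) by exact/measurable_EFinP.
have A0 : 0 <= \int[leb]_s (a s)%:E.
  by apply: integral_ge0 => s _; rewrite lee_fin.
have mar s : measurable_fun setT (fun t : measurableTypeR R => (a (t - s))%:E).
  by apply/measurable_EFinP; apply: (measurableT_comp ma); apply: measurable_funB.
rewrite -(ge0_integralZl leb measurableT mN (fun s _ => N0 s) A0).
apply: eq_integral => s _.
rewrite (ge0_integralZr leb measurableT (mar s) _ (N0 s)); last first.
  by move=> t _; rewrite lee_fin.
congr (_ * _); apply: (ge0_integral_shift s ma1) => r.
by rewrite lee_fin.
Qed.

Variable p : R.
Hypothesis p1 : (1 < p)%R.
Let p0 : (0 < p)%R. Proof. exact: lt_trans p1. Qed.
Variables (w : R -> R) (U : TX -> R).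
Hypothesis iw : leb.-integrable setT (EFin \o w).
Hypothesis mU : measurable_fun setT U.
Hypothesis Uoo : Lpint mu p U < +oo.

Let mw : measurable_fun setT w.
Proof. by apply/measurable_EFinP; exact: measurable_int _ iw. Qed.

Let woo : \int[leb]_s (`|w s|)%:E < +oo.
Proof. by case/integrableP : iw. Qed.

Let q := (p / (p - 1))%R.
Let q0 : (0 < q)%R. Proof. by rewrite divr_gt0// subr_gt0. Qed.
Let pq : (p^-1 + q^-1 = 1)%R.
Proof. by rewrite /q; field; rewrite ?gt_eqF//= subr_gt0. Qed.

Let mslice x : measurable_fun setT (fun s : measurableTypeR R => U (s, x)).
Proof. by apply: (measurableT_comp mU); exact: measurable_pair2. Qed.

Let mwr t : measurable_fun setT (fun s : measurableTypeR R => w (t - s)).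
Proof. by apply: (measurableT_comp mw); exact: measurable_reflect. Qed.

Let time_conv_pow z :
  (`|time_conv w U z| `^ p)%:E <=
  (\int[leb]_s (`|w s|)%:E) `^ (q^-1 * p) *
  \int[leb]_s (`|w (z.1 - s)| * `|U (s, z.2)| `^ p)%:E.
Proof.
case: z => t x /=; rewrite -poweR_EFin.
have H : (`|time_conv w U (t, x)|)%:E <=
    \int[leb]_s (`|w (t - s)| * `|U (s, x)|)%:E.
  rewrite /time_conv /line_conv /Rintegral/=; set y := \int[_]_s _.
  (* [y] may be infinite; then [fine y] is 0 and the bound still holds. *)
  apply: (@le_trans _ _ `|y|).
    by case: y => //= [|]; rewrite ?normr0 ?leey.
  apply: le_trans (le_abse_integral _ _ _) _ => //.
    by apply/measurable_EFinP; exact: measurable_funM.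
  by rewrite le_eqVlt; apply/orP; left; apply/eqP; apply: eq_integral => s _ /=;
    rewrite normrM.
apply: le_trans (ge0_le_poweR (ltW p0) _ H) _ => //.
have := @weighted_hoelder _ _ R leb p q p0 q0 pq (fun s => `|w (t - s)|)%R
  (fun s => `|U (s, x)|)%R.
(* Reflection makes the integral of [|w (t - s)|] the L_1 norm of [w], a factor independent of
   [t]. *)
rewrite (ge0_integral_reflect t (f := fun s => (`|w s|)%:E))//; last first.
  by apply/measurable_EFinP; exact: measurableT_comp.
by apply => //; exact: measurableT_comp.
Qed.

(** Integrating [time_conv_pow] over time and space gives the bound [W^(p/q) * W * Lpint mu p U],
    with [W] the L_1 norm of [w]. *)
Lemma Lpint_time_conv_lty : Lpint mu p (time_conv w U) < +oo.
Proof.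
pose A := (\int[leb]_s (`|w s|)%:E) `^ (q^-1 * p).
have mB : measurable_fun setT (fun y : TX * measurableTypeR R =>
    (`|w (y.1.1 - y.2)| * `|U (y.2, y.1.2)| `^ p)%:E).
  apply/measurable_EFinP; apply: measurable_funM.
    apply: measurableT_comp => //; apply: (measurableT_comp mw).
    by apply: measurable_funB => //; apply: measurableT_comp.
  apply: (measurableT_comp (measurable_powR _)); apply: measurableT_comp => //.
  apply: (measurableT_comp mU); apply: measurable_fun_pair => //.
  by apply: measurableT_comp.
pose B (z : TX) := \int[leb]_s (`|w (z.1 - s)| * `|U (s, z.2)| `^ p)%:E.
have mBz : measurable_fun setT B by exact: (measurable_fun_integral2 leb mB).
have B0 z : 0 <= B z by apply: integral_ge0 => s _; rewrite lee_fin mulr_ge0 ?powR_ge0.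
have mC := measurable_time_conv mw mU.
have mCp : measurable_fun setT (fun z => (`|time_conv w U z| `^ p)%:E).
  by apply/measurable_EFinP; apply: (measurableT_comp (measurable_powR _));
    exact: measurableT_comp.
have mBt t : measurable_fun setT (fun x => B (t, x)).
  by apply: (measurableT_comp mBz); exact: measurable_pair1.
have A0 : 0 <= A by exact: poweR_ge0.
apply: (@le_lt_trans _ _ (A * \int[leb]_t \int[mu]_x B (t, x))).
  rewrite -(ge0_integralZl leb measurableT (measurable_fun_integral2 mu mBz) _ A0);
    last by move=> t _; apply: integral_ge0 => x _; exact: B0.
  apply: ge0_le_integral => //.
  - by move=> t _; apply: integral_ge0 => x _; rewrite lee_fin powR_ge0.
  - exact: (measurable_fun_integral2 mu mCp).
  - by apply: measurable_funeM; exact: (measurable_fun_integral2 mu mBz).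
  move=> t _; rewrite -(ge0_integralZl mu measurableT (mBt t) (fun x _ => B0 _) A0).
  apply: ge0_le_integral => //.
  - by apply: (measurableT_comp mCp); exact: measurable_pair1.
  - by apply: measurable_funeM; exact: mBt.
have Afin : A \is a fin_num.
  by rewrite ge0_fin_numE ?poweR_ge0//; exact: poweR_lty.
apply: lte_mul_pinfty A0 Afin _.
(* At fixed [t], Tonelli in [(x, s)] separates the kernel from the space integral and leaves a
   scalar convolution in time. *)
have -> : \int[leb]_t \int[mu]_x B (t, x) =
    \int[leb]_t \int[leb]_s (`|w (t - s)|%:E * \int[mu]_x (`|U (s, x)| `^ p)%:E).
  apply: eq_integral => t _; rewrite /B/=.
  have mh : measurable_fun setT (fun z : X * measurableTypeR R =>
      (`|w (t - z.2)| * `|U (z.2, z.1)| `^ p)%:E).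
    apply: (measurableT_comp mB (g := fun z : X * measurableTypeR R => ((t, z.1), z.2))).
    by apply: measurable_fun_pair => //; apply: measurable_fun_pair.
  have fT := @fubini_tonelli _ _ _ _ R mu leb _ mh.
  transitivity (\int[leb]_s \int[mu]_x (`|w (t - s)| * `|U (s, x)| `^ p)%:E).
    by apply: fT => z; rewrite lee_fin mulr_ge0 ?powR_ge0.
  have mUs s : measurable_fun setT (fun x => (`|U (s, x)| `^ p)%:E).
    apply/measurable_EFinP; apply: (measurableT_comp (measurable_powR _)).
    apply: measurableT_comp => //; apply: (measurableT_comp mU).
    exact: measurable_pair1.
  apply: eq_integral => s _; rewrite -(ge0_integralZl mu measurableT (mUs s))//.
have maw : measurable_fun setT (fun s => `|w s|)%R by exact: measurableT_comp.
have mN : measurable_fun setT (fun s => \int[mu]_x (`|U (s, x)| `^ p)%:E).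
  apply: (measurable_fun_integral2 mu (f := fun z => (`|U z| `^ p)%:E)).
  by apply/measurable_EFinP; apply: (measurableT_comp (measurable_powR _));
    exact: measurableT_comp.
have N0 s : 0 <= \int[mu]_x (`|U (s, x)| `^ p)%:E.
  by apply: integral_ge0 => x _; rewrite lee_fin powR_ge0.
rewrite (ge0_integral_conv maw mN (fun s => normr_ge0 _) N0).
have W0 : 0 <= \int[leb]_s (`|w s|)%:E by exact: integral_ge0.
apply: lte_mul_pinfty W0 _ Uoo.
by rewrite ge0_fin_numE; [exact: woo|apply: integral_ge0].
Qed.

End young.

Section ae_le_Rintegral.
Context d (T : measurableType d) (R : realType) (mu : {measure set T -> \bar R}).

Lemma ae_le_Rintegral (f g : T -> R) :
  mu.-integrable setT (EFin \o f) -> mu.-integrable setT (EFin \o g) ->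
  {ae mu, forall x, f x <= g x} -> \int[mu]_x f x <= \int[mu]_x g x.
Proof.
move=> intf intg fg; rewrite -subr_ge0 -RintegralB//.
have ib : mu.-integrable setT (EFin \o (fun x => g x - f x)).
  have := integrableB measurableT intg intf.
  by apply: eq_integrable => // x _ /=; rewrite EFinB.
rewrite (_ : \int[mu]_x _ = \int[mu]_x `|g x - f x|).
  by apply: Rintegral_ge0.
rewrite /Rintegral; congr fine; apply: ae_eq_integral => //.
- exact: measurable_int _ ib.
- exact: measurable_int _ (integrable_norm ib).
- by apply: ae_imply fg _ => x fgx _ /=; rewrite ger0_norm// subr_ge0.
Qed.

End ae_le_Rintegral.

(** * Sections of jointly measurable functions *)

Section ae_sections.
Local Open Scope ereal_scope.
Context d (X : measurableType d) (R : realType).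
Variable mu : {sigma_finite_measure set X -> \bar R}.
Local Notation leb := (@lebesgue_measure R).
Local Notation TX := (measurableTypeR R * X)%type.

Lemma LnormE (p : R) (f : X -> R) :
  'N[mu]_p%:E[EFin \o f] = (\int[mu]_x (`|f x| `^ p)%:E) `^ p^-1.
Proof. by rewrite unlock. Qed.

Let mslice1 (F : TX -> R) t : measurable_fun setT F ->
  measurable_fun setT (fun x => F (t, x)).
Proof. by move=> mF; apply: (measurableT_comp mF); exact: measurable_pair1. Qed.

Let mslice2 (F : TX -> R) x : measurable_fun setT F ->
  measurable_fun setT (fun t => F (t, x)).
Proof. by move=> mF; apply: (measurableT_comp mF); exact: measurable_pair2. Qed.

Lemma measurable_Lnorm_section (p : R) (F : TX -> R) : measurable_fun setT F ->
  measurable_fun setT (fun t => 'N[mu]_p%:E[EFin \o (fun x => F (t, x))]).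
Proof.
move=> mF.
rewrite (_ : (fun t => _) =
  (fun t => (\int[mu]_x (`|F (t, x)| `^ p)%:E) `^ p^-1)); last first.
  by apply/funext => t; rewrite LnormE.
apply: (measurableT_comp (measurable_poweR _)).
apply: (measurable_fun_integral2 mu (f := fun z => (`|F z| `^ p)%:E)).
apply/measurable_EFinP; apply: (measurableT_comp (measurable_powR _)).
exact: measurableT_comp.
Qed.

(** By Tonelli both statements express that [|F|] has integral 0 over the product; joint
    measurability enters here. *)
Lemma ae_swap (F : TX -> R) : measurable_fun setT F ->
  {ae mu, forall x, {ae leb, forall t, F (t, x) = 0%R}} ->
  {ae leb, forall t, {ae mu, forall x, F (t, x) = 0%R}}.
Proof.
move=> mF F0.
have mG : measurable_fun setT (fun z => `|(F z)%:E|).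
  by apply: measurableT_comp => //; exact/measurable_EFinP.
have mx : measurable_fun setT (fun x => \int[leb]_t `|(F (t, x))%:E|).
  apply: (measurable_fun_integral2 leb
    (f := fun z : X * measurableTypeR R => `|(F (z.2, z.1))%:E|)).
  by apply: (measurableT_comp mG); exact: measurable_swap.
have mt : measurable_fun setT (fun t => \int[mu]_x `|(F (t, x))%:E|).
  exact: (measurable_fun_integral2 mu mG).
have E : \int[leb]_t \int[mu]_x `|(F (t, x))%:E| =
    \int[mu]_x \int[leb]_t `|(F (t, x))%:E|.
  have fT := @fubini_tonelli _ _ _ _ R leb mu _ mG.
  by apply: fT => z; exact: abse_ge0.
have Z : \int[mu]_x \int[leb]_t `|(F (t, x))%:E| = 0.
  rewrite -(integral0 mu setT); apply: ge0_ae_eq_integral => //.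
    by move=> x _; apply: integral_ge0.
  apply: ae_imply F0 _ => x Fx _.
  have mFx : measurable_fun setT (fun t => (F (t, x))%:E).
    by apply/measurable_EFinP; exact: mslice2.
  have [_ h] := ae_eq_integral_abs leb measurableT mFx; apply: h.
  by apply: ae_imply Fx _ => t Ft _ /=; rewrite Ft.
have Z2 : \int[leb]_t `|\int[mu]_x `|(F (t, x))%:E| | = 0.
  rewrite -Z -E; apply: eq_integral => t _; rewrite gee0_abs//.
  exact: integral_ge0.
have [h _] := ae_eq_integral_abs leb measurableT mt.
apply: ae_imply (h Z2) _ => t /(_ I) Ft.
have mFt : measurable_fun setT (fun x => (F (t, x))%:E).
  by apply/measurable_EFinP; exact: mslice1.
have [h' _] := ae_eq_integral_abs mu measurableT mFt.
by apply: ae_imply (h' Ft) _ => x /(_ I) [].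
Qed.

Variables (p : R).
Hypothesis p1 : (1 < p)%R.
Let q := (p / (p - 1))%R.
Let p0 : (0 < p)%R. Proof. exact: lt_trans p1. Qed.
Let q0 : (0 < q)%R. Proof. by rewrite divr_gt0// subr_gt0. Qed.
Let qp : (q^-1 + p^-1 = 1)%R.
Proof. by rewrite /q; field; rewrite ?gt_eqF//= subr_gt0. Qed.

(** [mu] may be infinite, so L_p need not embed into L_1. On each set [G n] of an exhaustion by sets
    of finite measure, Hoelder with the indicator bounds the integral of [|F|] over time and [G n]
    by [C] times the integral of the L_p norms. Countably many null sets are then joined. *)
Lemma ae_integrable_section (F : TX -> R) : measurable_fun setT F ->
  \int[leb]_t 'N[mu]_p%:E[EFin \o (fun x => F (t, x))] < +oo ->
  {ae mu, forall x, leb.-integrable setT (fun t => (F (t, x))%:E)}.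
Proof.
move=> mF Foo.
have /sigma_finiteP[G [GT _ Goo]] := sigma_finiteT mu.
pose g n x : R := \1_(G n) x.
have mG : measurable_fun setT (fun z => `|(F z)%:E|).
  by apply: measurableT_comp => //; exact/measurable_EFinP.
have mx : measurable_fun setT (fun x => \int[leb]_t `|(F (t, x))%:E|).
  apply: (measurable_fun_integral2 leb
    (f := fun z : X * measurableTypeR R => `|(F (z.2, z.1))%:E|)).
  by apply: (measurableT_comp mG); exact: measurable_swap.
have x0 x : 0 <= \int[leb]_t `|(F (t, x))%:E| by apply: integral_ge0.
have mN := measurable_Lnorm_section p mF.
have mgn n : measurable_fun setT (g n) by apply: measurable_indic; have [] := Goo n.
have gn0 n x : 0 <= (g n x)%:E by rewrite lee_fin /g indicE.
have H n : {ae mu, forall x, (g n x)%:E * \int[leb]_t `|(F (t, x))%:E| < +oo}.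
  have mn : measurable_fun setT (fun x => (g n x)%:E * \int[leb]_t `|(F (t, x))%:E|).
    by apply: emeasurable_funM => //; exact/measurable_EFinP.
  have mgz : measurable_fun setT (fun z : TX => (g n z.2)%:E * `|(F z)%:E|).
    apply: emeasurable_funM => //; apply/measurable_EFinP.
    exact: (measurableT_comp (mgn n)).
  have Ioo : \int[mu]_x ((g n x)%:E * \int[leb]_t `|(F (t, x))%:E|) < +oo.
    have -> : \int[mu]_x ((g n x)%:E * \int[leb]_t `|(F (t, x))%:E|) =
        \int[leb]_t \int[mu]_x ((g n x)%:E * `|(F (t, x))%:E|).
      have fT := @fubini_tonelli _ _ _ _ R leb mu _ mgz.
      transitivity (\int[mu]_x \int[leb]_t ((g n x)%:E * `|(F (t, x))%:E|)).
        apply: eq_integral => x _.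
        have mFx : measurable_fun setT (fun t => `|(F (t, x))%:E|).
          by apply: (measurableT_comp mG); exact: measurable_pair2.
        by rewrite (ge0_integralZl leb measurableT mFx (fun t _ => abse_ge0 _) (gn0 n x)).
      by apply/esym; apply: fT => z; apply: mule_ge0; [exact: gn0|exact: abse_ge0].
    pose C := 'N[mu]_q%:E[EFin \o g n].
    have C0 : 0 <= C by exact: Lnorm_ge0.
    have Coo : C < +oo.
      rewrite /C LnormE; apply: poweR_lty.
      (* An indicator equals its own [q]-th power, so [C] is a root of the measure of [G n]. *)
      rewrite (eq_integral (fun x => (\1_(G n) x)%:E)); last first.
        move=> x _; rewrite /g indicE normr_nat; case: (_ \in _) => /=.
          by rewrite powR1.
        by rewrite powR0// gt_eqF.
      by rewrite integral_indic ?setIT; have [] := Goo n.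
    have Cfin : C \is a fin_num by rewrite ge0_fin_numE.
    apply: (@le_lt_trans _ _
        (C * \int[leb]_t 'N[mu]_p%:E[EFin \o (fun x => F (t, x))])); last first.
      exact: (lte_mul_pinfty C0 Cfin Foo).
    rewrite -(ge0_integralZl leb measurableT mN (fun t _ => Lnorm_ge0 _ _ _) C0).
    apply: ge0_le_integral; [by []| |exact: (measurable_fun_integral2 mu mgz)|
      by apply: measurable_funeM; exact: mN|].
      by move=> t _; apply: integral_ge0 => x _; apply: mule_ge0;
        [exact: gn0|exact: abse_ge0].
    move=> t _.
    have := hoelder mu (mgn n) (mslice1 t mF) q0 p0 qp; rewrite Lnorm1.
    apply: le_trans; rewrite le_eqVlt; apply/orP; left; apply/eqP.
    apply: eq_integral => x _ /=; rewrite normrM EFinM.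
    by rewrite [X in _ = X%:E * _]ger0_norm// /g indicE.
  have I1 : mu.-integrable setT (fun x => (g n x)%:E * \int[leb]_t `|(F (t, x))%:E|).
    apply/integrableP; split => //.
    rewrite (eq_integral (fun x => (g n x)%:E * \int[leb]_t `|(F (t, x))%:E|))//.
    by move=> x _; rewrite gee0_abs//; apply: mule_ge0; [exact: gn0|exact: x0].
  apply: ae_imply (integrable_ae measurableT I1) _ => x /(_ I).
  by rewrite ge0_fin_numE//; apply: mule_ge0; [exact: gn0|exact: x0].
apply: ae_imply (ae_foralln H) _ => x Hx.
have [n _ Gnx] : (\bigcup_i G i) x by rewrite -GT.
apply/integrableP; split.
  by apply/measurable_EFinP; exact: mslice2.
by have := Hx n; rewrite /g indicE mem_set// mul1e.
Qed.

End ae_sections.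

(** * The duality map of L_p *)

Section duality_map.
Context {R : realType}.
Variable p : R.
Hypothesis p1 : 1 < p.

(* The paper's |y|^(p-2) y; at y = 0 the junk value 0 `^ (p - 2) is harmless. *)
Definition dual_pow (y : R) := `|y| `^ (p - 2) * y.

Lemma normr_dual_pow y : `|dual_pow y| = `|y| `^ (p - 1).
Proof.
rewrite /dual_pow normrM (ger0_norm (powR_ge0 _ _)) mulrC.
(* In this form the rule [x * x^(r - 1) = x^r] applies with [r = p - 1 > 0], also at [x = 0]. *)
have -> : p - 2 = p - 1 - 1 by ring.
by rewrite mulr_powRB1// subr_gt0.
Qed.

Lemma dual_powM y : dual_pow y * y = `|y| `^ p.
Proof.
have yy : y * y = `|y| * `|y|.
  by rewrite -!expr2; exact/esym/real_normK/num_real.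
rewrite /dual_pow -mulrA yy mulrCA; have -> : p - 2 = p - 1 - 1 by ring.
have p0 : 0 < p by exact: lt_trans p1.
rewrite [_ `^ _ * _]mulrC (mulr_powRB1 (normr_ge0 y)) ?subr_gt0//.
exact: (mulr_powRB1 (normr_ge0 y) p0).
Qed.

Lemma measurable_dual_pow d (X : measurableType d) (f : X -> R) :
  measurable_fun setT f -> measurable_fun setT (fun x => dual_pow (f x)).
Proof.
move=> mf; apply: measurable_funM => //.
by apply: (measurableT_comp (measurable_powR _)); exact: measurableT_comp.
Qed.

End duality_map.

(** * The inequality at a fixed time *)

Section core_inequality.
Context d (X : measurableType d) (R : realType).
Variable mu : {sigma_finite_measure set X -> \bar R}.
Local Notation leb := (@lebesgue_measure R).
Local Notation TX := (measurableTypeR R * X)%type.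
Variable p : R.
Hypothesis p1 : 1 < p.
Let q := p / (p - 1).
Let p0 : 0 < p. Proof. exact: lt_trans p1. Qed.
Let q0 : 0 < q. Proof. by rewrite divr_gt0// subr_gt0. Qed.
Let pn : p - 1 != 0. Proof. by rewrite gt_eqF// subr_gt0. Qed.
Let pz : p != 0. Proof. by rewrite gt_eqF. Qed.
Let qp : q^-1 + p^-1 = 1.
Proof. by rewrite /q; field; rewrite ?gt_eqF//= subr_gt0. Qed.

Variables (a : X -> R) (U : TX -> R) (w n : R -> R).
Hypothesis ma : measurable_fun setT a.
Hypothesis mU : measurable_fun setT U.
Hypothesis mw : measurable_fun setT w.
Hypothesis w0 : forall s, w s <= 0.
Hypothesis aoo : ('N[mu]_p%:E[EFin \o a] < +oo)%E.
Hypothesis Un : {ae leb, forall s,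
  ('N[mu]_p%:E[EFin \o (fun x => U (s, x))] <= (n s)%:E)%E}.
Hypothesis iwn : leb.-integrable setT (fun s => (w s * n s)%:E).

Let N := fine ('N[mu]_p%:E[EFin \o a])%E.
Let g x := dual_pow p (a x).
Let mg : measurable_fun setT g. Proof. exact: measurable_dual_pow. Qed.

Let Na : ('N[mu]_p%:E[EFin \o a] = N%:E)%E.
Proof. by rewrite fineK// ge0_fin_numE// Lnorm_ge0. Qed.

Let N0 : 0 <= N. Proof. by apply: fine_ge0; exact: Lnorm_ge0. Qed.

(** Conjugacy gives [(p - 1) q = p], hence [|g|^q = |a|^p], and [p / q = p - 1]. *)
Lemma Lnorm_dual_pow : ('N[mu]_q%:E[EFin \o g] = (N `^ (p - 1))%:E)%E.
Proof.
rewrite LnormE.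
have -> : (\int[mu]_x (`|g x| `^ q)%:E = \int[mu]_x (`|a x| `^ p)%:E)%E.
  apply: eq_integral => x _; rewrite normr_dual_pow// -powRrM.
  by congr (_ `^ _)%:E; rewrite /q; field; exact: pn.
have -> : (\int[mu]_x (`|a x| `^ p)%:E = 'N[mu]_p%:E[EFin \o a] `^ p)%E.
  by rewrite poweR_Lnorm ?gt_eqF.
rewrite Na !poweR_EFin -powRrM; congr (_ `^ _)%:E.
by rewrite /q; field; rewrite ?pz ?pn.
Qed.

Let hoelder_section s : ('N[mu]_p%:E[EFin \o (fun x => U (s, x))] <= (n s)%:E)%E ->
  (\int[mu]_x `|(g x * U (s, x))%:E| <= (N `^ (p - 1) * n s)%:E)%E.
Proof.
move=> Us; have mUs : measurable_fun setT (fun x => U (s, x)).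
  by apply: (measurableT_comp mU); exact: measurable_pair1.
have := hoelder mu mg mUs q0 p0 qp; rewrite Lnorm1 Lnorm_dual_pow => H.
apply: (le_trans H); rewrite EFinM; apply: lee_wpmul2l => //.
by rewrite lee_fin powR_ge0.
Qed.

(** In the application [a] is the slice of [u] at a fixed time [t], [w s] is the kernel at [t - s],
    and [n s] bounds the norm of the slice at time [s] for almost all [s]. *)
Let Phi (z : X * measurableTypeR R) := g z.1 * (w z.2 * U (z.2, z.1)).

Let mPhi : measurable_fun setT Phi.
Proof.
apply: measurable_funM; first exact: (measurableT_comp mg).
apply: measurable_funM; first exact: (measurableT_comp mw).
by apply: (measurableT_comp mU); exact: measurable_swap.
Qed.

Let mgU s : measurable_fun setT (fun x => `|(g x * U (s, x))%:E|%E).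
Proof.
apply: measurableT_comp => //; apply/measurable_EFinP; apply: measurable_funM => //.
by apply: (measurableT_comp mU); exact: measurable_pair1.
Qed.

Let iPhi : (mu \x leb)%E.-integrable setT (EFin \o Phi).
Proof.
have mE : measurable_fun setT (EFin \o Phi) by exact/measurable_EFinP.
have [_ h] := integrable21ltyP mu leb mE; apply: h.
have int0 s : (0 <= \int[mu]_x `|(EFin \o Phi) (x, s)|)%E by exact: integral_ge0.
have mI : measurable_fun setT (fun s => \int[mu]_x `|(EFin \o Phi) (x, s)|)%E.
  apply: (measurable_fun_integral2 mu
    (f := fun z : measurableTypeR R * X => `|(EFin \o Phi) (z.2, z.1)|%E)).
  apply: measurableT_comp => //; apply: (measurableT_comp mE).
  exact: measurable_swap.
have iwnN := integrable_norm (integrableZlR measurableT (N `^ (p - 1)) iwn).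
have [miwn iwnoo] := integrableP _ _ _ iwnN.
apply: le_lt_trans iwnoo.
have mr : measurable_fun setT (fun s => `|(`|N `^ (p - 1) * (w s * n s)|)%:E|%E).
  exact: measurableT_comp.
apply: (ae_ge0_le_integral measurableT (fun s _ => int0 s) mI _ mr) => //.
apply: ae_imply Un _ => s Us _ /=.
have -> : (\int[mu]_x `|Phi (x, s)|%:E =
    `|w s|%:E * \int[mu]_x `|(g x * U (s, x))%:E|)%E.
  rewrite -(ge0_integralZl mu measurableT (mgU s) (fun x _ => abse_ge0 _))//.
  by apply: eq_integral => x _ /=; rewrite -EFinM -normrM /Phi/= mulrCA.
have H := hoelder_section Us.
(* The Hoelder bound on slices leaves [N^(p - 1) |w s| n s], whose integral is finite by [iwn]. *)
apply: (@le_trans _ _ (`|w s|%:E * (N `^ (p - 1) * n s)%:E)%E).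
  by apply: lee_wpmul2l => //; rewrite lee_fin.
rewrite -EFinM lee_fin normr_id [in leRHS]mulrCA normrM ler_wpM2l//.
exact: ler_norm.
Qed.

(** Where [g x] is nonzero, dividing the integrable section of [Phi] by it makes [w s * U (s, x)]
    integrable in [s]; where [g x] is 0 both sides are 0, whatever the integral on the right. *)
Let PhiE : {ae mu, forall x, \int[leb]_s Phi (x, s) = g x * \int[leb]_s (w s * U (s, x))}.
Proof.
apply: ae_imply (ae_integrable1 iPhi) _ => x ix.
have [gx0|gx0] := eqVneq (g x) 0.
  rewrite gx0 mul0r -[RHS](mul0r (fine (leb setT))) -Rintegral_cst//.
  by apply: eq_Rintegral => s _; rewrite /Phi/= gx0 mul0r.
have iwU : leb.-integrable setT (fun s => (w s * U (s, x))%:E).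
  have := integrableZlR measurableT (g x)^-1 ix.
  by apply: eq_integrable => // s _ /=; rewrite /Phi/= mulKf.
by rewrite /Phi/= RintegralZl.
Qed.

Let mS : measurable_fun setT (fun x => \int[leb]_s (w s * U (s, x))).
Proof.
apply: (measurable_fun_Rintegral2 leb
  (f := fun z : X * measurableTypeR R => w z.2 * U (z.2, z.1))).
apply: measurable_funM; first exact: (measurableT_comp mw).
by apply: (measurableT_comp mU); exact: measurable_swap.
Qed.

Lemma integrable_dual_pow_conv :
  mu.-integrable setT (fun x => (g x * \int[leb]_s (w s * U (s, x)))%:E).
Proof.
have [mi ioo] := integrableP _ _ _ (integrable_Rintegral2 iPhi).
have mgS : measurable_fun setT (fun x => (g x * \int[leb]_s (w s * U (s, x)))%:E).
  by apply/measurable_EFinP; exact: measurable_funM.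
apply/integrableP; split => //; apply: le_lt_trans ioo.
rewrite le_eqVlt; apply/orP; left; apply/eqP.
apply: ae_eq_integral => //; [exact: measurableT_comp|exact: measurableT_comp|].
by apply: ae_imply PhiE _ => x -> _.
Qed.

(* Hoelder's inequality in space for each pair (t, s) of times; the sign of the
   kernel reverses the inequality. *)
Lemma core_inequality :
  N `^ (p - 1) * \int[leb]_s (w s * n s) <=
  \int[mu]_x (g x * \int[leb]_s (w s * U (s, x))).
Proof.
have -> : \int[mu]_x (g x * \int[leb]_s (w s * U (s, x))) =
    \int[leb]_s \int[mu]_x Phi (x, s).
  rewrite -Rintegral_fubini// /Rintegral; congr fine.
  apply: ae_eq_integral => //.
  - exact: measurable_int _ integrable_dual_pow_conv.
  - exact: measurable_int _ (integrable_Rintegral2 iPhi).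
  - by apply: ae_imply PhiE _ => x /= <- _.
rewrite -RintegralZl//; apply: ae_le_Rintegral.
- exact: integrableZlR.
- exact: (integrable_Rintegral2 (integrable_swap iPhi)).
apply: ae_imply Un _ => s Us.
have H := hoelder_section Us.
have igU : mu.-integrable setT (fun x => (g x * U (s, x))%:E).
  apply/integrableP; split; last by apply: (le_lt_trans H); rewrite ltry.
  apply/measurable_EFinP; apply: measurable_funM => //.
  by apply: (measurableT_comp mU); exact: measurable_pair1.
have -> : \int[mu]_x Phi (x, s) = w s * \int[mu]_x (g x * U (s, x)).
  by rewrite -RintegralZl//; apply: eq_Rintegral => x _; rewrite /Phi/= mulrCA.
rewrite mulrCA; apply: ler_wnM2l => //.
rewrite -lee_fin fineK; last exact: integrable_fin_num.
apply: le_trans H; apply: le_integral => //; first exact: integrable_abse.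
by move=> x _; exact: lee_abs.
Qed.

End core_inequality.

Lemma ae_forall_countable d (X : measurableType d) (R : realType)
    (mu : {measure set X -> \bar R}) (C : countType) (Q : C -> X -> Prop) :
  (forall z, {ae mu, forall x, Q z x}) -> {ae mu, forall x, forall z, Q z x}.
Proof.
move=> aeQ.
have H i : {ae mu, forall x, if unpickle i is Some z then Q z x else True}.
  by case: (unpickle i) => [z|]; [exact: aeQ|exact: aeW].
apply: ae_imply (ae_foralln H) _ => x Hx z.
by have := Hx (pickle z); rewrite pickleK.
Qed.

Lemma weak_derivative_unique (R : realType) (T : R) (v w1 w2 : R -> R) :
  weak_derivative T v w1 -> weak_derivative T v w2 ->
  {ae @lebesgue_measure R, forall t, 0 < t < T -> w1 t = w2 t}.
Proof.
move=> [_ i1 h1] [_ i2 h2].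
suff H : {ae @lebesgue_measure R, forall t, 0 < t < T -> w1 t - w2 t = 0}.
  by apply: ae_imply H _ => t /[apply] /eqP; rewrite subr_eq0 => /eqP.
apply: (@ae_eq0_bump R T (fun t => w1 t - w2 t)).
  have := fun m => integrableB m i1 i2; move=> /(_ (measurable_itv _)).
  by apply: eq_integrable => // t _ /=; rewrite EFinB.
move=> a b n a0 ab bT; have Cb := C1c_bump n a0 (ltW ab) bT.
under eq_Rintegral do rewrite mulrBr.
rewrite RintegralB//; [|exact: integrable_bumpM|exact: integrable_bumpM].
by rewrite -[X in X - _]opprK -h1// -[X in _ - X]opprK -h2// subrr.
Qed.

(** * The Bochner-type spaces and uniqueness of the weak time derivative *)

Section vector_valued.
Context {R : realType} {N : nat}.
Local Notation leb := (@lebesgue_measure R).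
Local Notation mu := (lebesgueRn R N).
Local Notation TX := (measurableTypeR R * Rn R N)%type.
Variables (T p : R) (Omega : set (Rn R N)).
Hypothesis p1 : 1 < p.
Hypothesis T0 : 0 < T.
Hypothesis mO : measurable Omega.
Implicit Types (u v : R -> Rn R N -> R) (F : TX -> R).

Let p0 : 0 < p. Proof. exact: lt_trans p1. Qed.

Definition zero_ext u : TX -> R := (fun z => u z.1 z.2) \_ (`[0, T] `*` Omega).

Definition slice_norm F (t : R) : \bar R := Lnorm mu p%:E (EFin \o (fun x => F (t, x))).

Lemma zero_extE u t x : 0 <= t <= T -> Omega x -> zero_ext u (t, x) = u t x.
Proof.
by move=> tT Ox; rewrite /zero_ext patchE mem_set//; split=> //=; rewrite in_itv.
Qed.

Lemma zero_ext_out u t x : ~ Omega x -> zero_ext u (t, x) = 0.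
Proof. by move=> nOx; rewrite /zero_ext patchE memNset// => -[]. Qed.

Let mJ : measurable (`[0, T] `*` Omega : set TX).
Proof. by apply: measurableX. Qed.

Let slice_zero_ext u t : 0 <= t <= T ->
  Lp_norm Omega p (u t) = slice_norm (zero_ext u) t.
Proof.
move=> tT; rewrite /Lp_norm /slice_norm; congr Lnorm; apply/funext => x /=.
rewrite patchE; case: ifPn => [/set_mem Ox|]; first by rewrite zero_extE.
by rewrite notin_setE => Ox; rewrite zero_ext_out.
Qed.

Let slice_norm_out u t : ~ (0 <= t <= T) -> slice_norm (zero_ext u) t = 0%E.
Proof.
move=> tT; rewrite /slice_norm -(@Lnorm0 _ _ _ mu p%:E); last first.
  by rewrite eqe gt_eqF.
apply: eq_Lnorm => x /=; rewrite /zero_ext patchE memNset// => -[/=].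
by rewrite in_itv/= => /tT.
Qed.

Lemma LqLpE (q : R) u : LqLp Omega T q p u <->
  measurable_fun setT (zero_ext u) /\
  (Lnorm leb q%:E (slice_norm (zero_ext u)) < +oo)%E.
Proof.
have E : (fun t => Lp_norm Omega p (u t)) \_ `[0%R, T] = slice_norm (zero_ext u).
  apply/funext => t; rewrite patchE; case: ifPn.
    by rewrite inE/= in_itv/= => tT; rewrite slice_zero_ext.
  by rewrite notin_setE/= in_itv/= => tT; rewrite slice_norm_out.
rewrite /LqLp E; split=> -[mu_ ?]; split=> //.
  exact: (measurable_restrictT _ mJ).1.
exact: (measurable_restrictT _ mJ).2.
Qed.

Lemma LpLp_Lpint u : LqLp Omega T p p u -> (Lpint mu p (zero_ext u) < +oo)%E.
Proof.
move=> /LqLpE[_ /(poweR_lty p)]; rewrite poweR_Lnorm ?gt_eqF//.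
apply: le_lt_trans; rewrite le_eqVlt; apply/orP; left; apply/eqP.
apply: eq_integral => t _; rewrite gee0_abs ?Lnorm_ge0//.
by rewrite /slice_norm poweR_Lnorm ?gt_eqF.
Qed.

(** On the bounded interval that carries [F] one has [y <= 1 + y^p], so the integral is at most the
    length of [[0, T]] plus [Lpint mu p F]. *)
Lemma slice_norm_lty F : measurable_fun setT F -> (Lpint mu p F < +oo)%E ->
  (forall t x, ~ (0 <= t <= T) -> F (t, x) = 0) ->
  (\int[leb]_t slice_norm F t < +oo)%E.
Proof.
move=> mF Foo F0.
have mN : measurable_fun setT (slice_norm F) := measurable_Lnorm_section mu p mF.
have mNp : measurable_fun setT (fun t => slice_norm F t `^ p)%E.
  exact: (measurableT_comp (measurable_poweR _)).
have N0 t : (0 <= slice_norm F t)%E by exact: Lnorm_ge0.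
pose I t : \bar R := (\1_(`[0, T]%classic : set R) t)%:E.
have I0 t : (0 <= I t)%E by rewrite lee_fin indicE.
have mI : measurable_fun setT I.
  by apply/measurable_EFinP; exact: measurable_indic.
have Np0 t : (0 <= slice_norm F t `^ p)%E by exact: poweR_ge0.
apply: (@le_lt_trans _ _ (\int[leb]_t (I t + slice_norm F t `^ p))%E).
  apply: ge0_le_integral; [by []|by move=> t _; exact: N0|exact: mN|
    by apply: emeasurable_funD|].
  move=> t _; have [tT|/negP tT] := boolP (0 <= t <= T).
    rewrite /I indicE mem_set/= ?in_itv//.
    by apply: le_1DpoweR => //; exact: ltW.
  rewrite (_ : slice_norm F t = 0%E) ?adde_ge0 ?poweR_ge0//.
  rewrite /slice_norm -(@Lnorm0 _ _ _ mu p%:E) ?eqe ?gt_eqF//.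
  by apply: eq_Lnorm => x /=; rewrite F0.
rewrite (ge0_integralD leb measurableT (fun t _ => I0 t) mI (fun t _ => Np0 t) mNp).
apply: lte_add_pinfty.
  have /integrableP[_] := @integrable_indic_itv R 0 T true false.
  apply: le_lt_trans; rewrite le_eqVlt; apply/orP; left; apply/eqP.
  by apply: eq_integral => t _; rewrite gee0_abs.
apply: le_lt_trans Foo; rewrite le_eqVlt; apply/orP; left; apply/eqP.
by apply: eq_integral => t _; rewrite /slice_norm poweR_Lnorm ?gt_eqF.
Qed.

Lemma L1Lp_slice_norm u : LqLp Omega T 1 p u ->
  (\int[leb]_t slice_norm (zero_ext u) t < +oo)%E.
Proof.
move=> /LqLpE[_]; rewrite Lnorm1; apply: le_lt_trans.
rewrite le_eqVlt; apply/orP; left; apply/eqP.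
by apply: eq_integral => t _; rewrite gee0_abs// Lnorm_ge0.
Qed.

Lemma Lpint_L1Lp F v : measurable_fun setT F -> (Lpint mu p F < +oo)%E ->
  (forall t x, 0 <= t <= T -> Omega x -> v t x = F (t, x)) -> LqLp Omega T 1 p v.
Proof.
move=> mF Foo vF.
have E : zero_ext v = F \_ (`[0, T] `*` Omega).
  apply/funext => -[t x]; rewrite /zero_ext !patchE.
  case: ifPn => // /set_mem[/=]; rewrite in_itv/= => tT Ox; exact: vF.
have mv : measurable_fun setT (zero_ext v).
  by rewrite E; apply: (measurable_restrictT _ mJ).1; exact: measurable_funTS.
apply/LqLpE; split => //; rewrite Lnorm1.
have := @slice_norm_lty (zero_ext v) mv.
rewrite (_ : (\int[leb]_t `|slice_norm (zero_ext v) t|)%E =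
  (\int[leb]_t slice_norm (zero_ext v) t)%E); last first.
  by apply: eq_integral => t _; rewrite gee0_abs// Lnorm_ge0.
apply.
  apply: le_lt_trans Foo; apply: le_Lpint => // z.
  by rewrite E patchE; case: ifP => // _; rewrite normr0.
move=> t x tT; rewrite /zero_ext patchE memNset// => -[/=].
by rewrite in_itv/= => /tT.
Qed.

(** Over the rational bumps the exceptional null sets join into one. For the remaining [x] the
    scalar argument gives equality at almost all [t], and [ae_swap] exchanges the quantifiers. *)
Lemma weak_time_derivative_unique v w1 w2 :
  weak_time_derivative Omega T p v w1 -> weak_time_derivative Omega T p v w2 ->
  {ae leb, forall t, 0 < t < T ->
    {ae mu, forall x, Omega x -> w1 t x = w2 t x}}.
Proof.
move=> [_ L1 h1] [_ L2 h2].
have [m1 _] := (LqLpE 1 w1).1 L1; have [m2 _] := (LqLpE 1 w2).1 L2.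
(* Cut to the open interval, since the weak equations concern []0, T[] only; the zero extensions
   make [D] jointly measurable, as [ae_swap] demands. *)
pose D (z : TX) := if 0 < z.1 < T then zero_ext w1 z - zero_ext w2 z else 0.
have mD : measurable_fun setT D.
  apply: measurable_fun_ifT => //; last exact: measurable_funB.
  by apply: measurable_and; apply: measurable_fun_ltr => //; exact: measurable_fst.
have s1 := ae_integrable_section p1 m1 (L1Lp_slice_norm L1).
have s2 := ae_integrable_section p1 m2 (L1Lp_slice_norm L2).
pose Q (z : rat * rat * nat) (x : Rn R N) := 0 < ratr z.1.1 :> R ->
  ratr z.1.1 < ratr z.1.2 :> R -> ratr z.1.2 < T -> Omega x ->
  \int[leb]_(t in `]0, T[) (bump z.2 (ratr z.1.1) (ratr z.1.2) t * w1 t x) =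
  \int[leb]_(t in `]0, T[) (bump z.2 (ratr z.1.1) (ratr z.1.2) t * w2 t x).
have aeQ z : {ae mu, forall x, Q z x}.
  case: z => -[a b] n; rewrite /Q/=.
  have [/andP[/andP[a0 ab] bT]|nab] := boolP ((0 < ratr a :> R) &&
      (ratr a < ratr b :> R) && (ratr b < T)); last first.
    by apply: aeW => x a0 ab bT; case/negP: nab; rewrite a0 ab bT.
  have Cb := C1c_bump n a0 (ltW ab) bT.
  apply: ae_imply2 (h1 _ Cb) (h2 _ Cb) _ => x e1 e2 _ _ _ Ox.
  by apply: oppr_inj; rewrite -e1// -e2.
have D0 : {ae mu, forall x, {ae leb, forall t, D (t, x) = 0}}.
  have s12 := ae_imply2 s1 s2 (fun x i1 i2 => conj i1 i2).
  apply: ae_imply2 (ae_forall_countable aeQ) s12 _ => x Qx [i1 i2].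
  have [Ox|Ox] := pselect (Omega x); last first.
    apply: aeW => t; rewrite /D/= !zero_ext_out// subr0.
    by case: ifP.
  have itv_w w : leb.-integrable setT (fun t => (zero_ext w (t, x))%:E) ->
      leb.-integrable `]0, T[ (fun t => (w t x)%:E).
    move=> iw.
    have : leb.-integrable `]0, T[ (fun t => (zero_ext w (t, x))%:E).
      exact: (@integrableS _ (measurableTypeR R) R leb setT).
    apply: eq_integrable => // t; rewrite inE/= in_itv/= => /andP[t0 tT].
    by rewrite zero_extE// !ltW.
  have j1 := itv_w _ i1; have j2 := itv_w _ i2.
  have H : {ae leb, forall t, 0 < t < T -> w1 t x - w2 t x = 0}.
    apply: (@ae_eq0_bump R T (fun t => w1 t x - w2 t x)).
      have := fun m => integrableB m j1 j2; move=> /(_ (measurable_itv _)).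
      by apply: eq_integrable => // t _ /=; rewrite EFinB.
    move=> a b n a0 ab bT; under eq_Rintegral do rewrite mulrBr.
    rewrite RintegralB//; [|exact: integrable_bumpM|exact: integrable_bumpM].
    by have /= -> := Qx (a, b, n) a0 ab bT Ox; rewrite subrr.
  apply: ae_imply H _ => t Ht; rewrite /D/=; case: ifP => // tT.
  have /andP[/ltW t0 /ltW tT'] := tT.
  by rewrite !zero_extE ?t0 ?tT'// Ht.
apply: ae_imply (ae_swap mD D0) _ => t Dt tT.
apply: ae_imply Dt _ => x; rewrite /D/= tT.
have /andP[/ltW t0 /ltW tT'] := tT.
by move=> + Ox; rewrite !zero_extE ?t0 ?tT'// => /eqP; rewrite subr_eq0 => /eqP.
Qed.

End vector_valued.

(** * Explicit derivatives and the inequality for almost all times *)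

Section main.
Context {R : realType} {N : nat}.
Local Notation leb := (@lebesgue_measure R).
Local Notation mu := (lebesgueRn R N).
Local Notation TX := (measurableTypeR R * Rn R N)%type.
Variables (p T : R) (Omega : set (Rn R N)) (k : R -> R) (u : R -> Rn R N -> R).
Hypothesis p1 : 1 < p.
Hypothesis T0 : 0 < T.
Hypothesis mO : measurable Omega.
Hypothesis kW : W11 T k.
Hypothesis uL : LqLp Omega T p p u.
Variables (c : R) (w : R -> R).
Hypothesis iw : leb.-integrable setT (EFin \o w).
Hypothesis wle0 : forall t, w t <= 0.
Hypothesis wout : forall t, ~ (0 < t < T) -> w t = 0.
Hypothesis kE : {ae leb, forall t, 0 < t < T -> k t = c + primitive w t}.

Let p0 : 0 < p. Proof. exact: lt_trans p1. Qed.
Let normu t := fine (Lp_norm Omega p (u t)).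
Let V := normu \_ `]0, T[.
(** Cut to the open interval as in [convE], so that for [x] in [Omega] the rows of [U] are exactly
    the functions that enter [line_conv]. *)
Let U (z : TX) := if 0 < z.1 < T then zero_ext T Omega u z else 0.
Let S := time_conv w U.
Let du0 t x := c * U (t, x) + S (t, x).
Let dn0 t := c * V t + line_conv w V t.

Let mk : measurable_fun `]0, T[ k.
Proof.
by have [w' [ik _ _]] := kW; apply/measurable_EFinP; exact: measurable_int _ ik.
Qed.

Let mw : measurable_fun setT w.
Proof. by apply/measurable_EFinP; exact: measurable_int _ iw. Qed.

Let mE : measurable_fun setT (zero_ext T Omega u).
Proof. by have [] := (LqLpE T p1 mO p u).1 uL. Qed.

Let mU : measurable_fun setT U.
Proof.
apply: measurable_fun_ifT => //.
by apply: measurable_and; apply: measurable_fun_ltr => //; exact: measurable_fst.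
Qed.

Let Uoo : (Lpint mu p U < +oo)%E.
Proof.
apply: le_lt_trans (LpLp_Lpint p1 mO uL); apply: le_Lpint => // z.
by rewrite /U; case: ifP => // _; rewrite normr0.
Qed.

Let UE t x : 0 < t < T -> Omega x -> U (t, x) = u t x.
Proof.
by move=> tT Ox; rewrite /U/= tT zero_extE//; case/andP: tT => *; rewrite !ltW.
Qed.

Let Uout t x : ~ (0 < t < T) -> U (t, x) = 0.
Proof. by move=> /negP/negbTE tT; rewrite /U/= tT. Qed.

Let UoutO t x : ~ Omega x -> U (t, x) = 0.
Proof. by move=> Ox; rewrite /U zero_ext_out// if_same. Qed.

Let Urow x : Omega x -> (fun s => U (s, x)) = (u^~ x) \_ `]0, T[.
Proof.
move=> Ox; apply/funext => s; rewrite patchE mem_setE in_itv/=.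
by case: ifPn => [sT|/negP sT]; [rewrite UE|rewrite Uout].
Qed.

Let sliceU t : 0 < t < T -> Lp_norm Omega p (u t) = slice_norm p U t.
Proof.
move=> tT; rewrite /Lp_norm /slice_norm; congr Lnorm; apply/funext => x /=.
rewrite patchE; case: ifPn => [/set_mem Ox|]; first by rewrite UE.
by rewrite notin_setE => Ox; rewrite UoutO.
Qed.

Let sliceU0 t : ~ (0 < t < T) -> slice_norm p U t = 0%E.
Proof.
move=> tT; rewrite /slice_norm -(@Lnorm0 _ _ _ mu p%:E) ?eqe ?gt_eqF//.
by apply: eq_Lnorm => x /=; rewrite Uout.
Qed.

Let msl : measurable_fun setT (slice_norm p U) := measurable_Lnorm_section mu p mU.

Let VE t : V t = fine (slice_norm p U t).
Proof.
rewrite /V patchE mem_setE in_itv/=.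
by case: ifPn => [tT|/negP tT]; [rewrite /normu sliceU|rewrite sliceU0].
Qed.

Let Uslice_lty : (\int[leb]_t slice_norm p U t < +oo)%E.
Proof.
apply: (slice_norm_lty (T := T) p1 mU Uoo) => t x tT; apply: Uout => /andP[t0 tT'].
by apply: tT; apply/andP; split; exact: ltW.
Qed.

Let islice : leb.-integrable setT (slice_norm p U).
Proof.
apply/integrableP; split=> //; apply: le_lt_trans Uslice_lty.
rewrite le_eqVlt; apply/orP; left; apply/eqP; apply: eq_integral => t _.
by rewrite gee0_abs// Lnorm_ge0.
Qed.

(** The slice norm is integrable in time, hence finite almost everywhere; at the exceptional times
    [fine] makes [V] equal to 0. *)
Let slice_fin : {ae leb, forall t, slice_norm p U t = (V t)%:E}.
Proof.
apply: ae_imply (integrable_ae measurableT islice) _ => t /(_ I) tfin.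
by rewrite VE fineK.
Qed.

Let iV : leb.-integrable setT (EFin \o V).
Proof.
apply: le_integrable islice => //.
  apply/measurable_EFinP; rewrite (_ : V = fine \o slice_norm p U).
    by apply: measurableT_comp.
  by apply/funext => t; rewrite VE.
by move=> t _ /=; rewrite VE; case: (slice_norm p U t) => //=; rewrite ?normr0 ?leey.
Qed.

Let inormu : leb.-integrable `]0, T[ (EFin \o normu).
Proof. exact: (integrable_patchP leb _ _).2. Qed.

Lemma weak_derivative_conv_norm : weak_derivative T (conv k normu) dn0.
Proof. exact: (weak_derivative_conv T0 mk iw wout kE inormu). Qed.

Let mS : measurable_fun setT S. Proof. exact: measurable_time_conv. Qed.

Let mdu0 : measurable_fun setT (fun z => c * U z + S z).
Proof. by apply: measurable_funD => //; exact: measurable_funM. Qed.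

(** Young's inequality and the boundedness of the time interval place both functions in L_1 in time
    with values in L_p. The equation is the scalar one at each [x] with an integrable section, and
    this set of full measure is the same for all [phi]. *)
Lemma weak_time_derivative_vconv : weak_time_derivative Omega T p (vconv k u) du0.
Proof.
have ik : leb.-integrable setT (EFin \o (k \_ `]0, T[)).
  by have [w' [ik _ _]] := kW; apply: (integrable_patchP leb _ _).1.
have ik0 : measurable_fun setT (k \_ `]0, T[).
  by apply/measurable_EFinP; exact: measurable_int _ ik.
have mrow x : Omega x -> measurable_fun `]0, T[ (u^~ x).
  move=> Ox; apply: (measurable_restrictT _ _).2 => //; rewrite -Urow//.
  by apply: (measurableT_comp mU); exact: measurable_pair2.
split.
- apply: (@Lpint_L1Lp _ _ T p Omega p1 mO (time_conv (k \_ `]0, T[) U)).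
  + exact: measurable_time_conv.
  + exact: Lpint_time_conv_lty.
  + move=> t x tT Ox; rewrite /vconv (@convE _ T)//; last exact: mrow.
    by rewrite /time_conv/= Urow.
- have Soo := Lpint_time_conv_lty p1 iw mU Uoo.
  have duoo := Lpint_ZlD_lty p1 c mU mS Uoo Soo.
  exact: (Lpint_L1Lp p1 mO mdu0 duoo (fun t x _ _ => erefl)).
move=> phi Cphi.
have := ae_integrable_section p1 mU Uslice_lty.
move=> H; apply: ae_imply H _ => x iUx Ox.
have iux : leb.-integrable `]0, T[ (EFin \o (u^~ x)).
  by apply: (integrable_patchP leb _ _).2 => //; rewrite -Urow.
have [_ _ h] := weak_derivative_conv T0 mk iw wout kE iux.
by rewrite /vconv h// -Urow.
Qed.

Lemma ae_fundamental_inequality dn du :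
  weak_derivative T (conv k normu) dn ->
  weak_time_derivative Omega T p (vconv k u) du ->
  {ae leb, forall t, 0 < t < T ->
    normu t `^ (p - 1) * dn t <=
    \int[mu]_(x in Omega) (`|u t x| `^ (p - 2) * u t x * du t x)}.
Proof.
move=> hdn hdu.
(* The good times: [dn] and [du] agree with the explicit derivatives, [w (t - s) * V s] is
   integrable in [s], and the norm of [u t] is finite. *)
have A1 := weak_derivative_unique hdn weak_derivative_conv_norm.
have A2 := weak_time_derivative_unique p1 mO hdu weak_time_derivative_vconv.
have A3 := ae_integrable1 (integrable_conv iw iV).
have A12 := ae_imply2 A1 A2 (fun t a b => conj a b).
have A34 := ae_imply2 A3 slice_fin (fun t a b => conj a b).
apply: ae_imply2 A12 A34 _ => t [+ +] [iwV tfin] tT.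
move=> /(_ tT) -> /(_ tT) duE.
pose a x := U (t, x).
have ma : measurable_fun setT a.
  by apply: (measurableT_comp mU); exact: measurable_pair1.
have aE : Lnorm mu p%:E (EFin \o a) = (V t)%:E by exact: tfin.
have aoo : (Lnorm mu p%:E (EFin \o a) < +oo)%E by rewrite aE ltry.
have Vt : normu t = V t by rewrite /V patchE mem_setE in_itv/= tT.
have V0 : 0 <= V t by rewrite -lee_fin -aE Lnorm_ge0.
pose wt s := w (t - s).
have mwt : measurable_fun setT wt.
  by apply: (measurableT_comp mw); exact: measurable_reflect.
have wt0 s : wt s <= 0 by exact: wle0.
have Un : {ae leb, forall s, (Lnorm mu p%:E (EFin \o (fun x => U (s, x))) <= (V s)%:E)%E}.
  by apply: ae_imply slice_fin _ => s <-.
have core := core_inequality p1 ma mU mwt wt0 aoo Un iwV.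
have icore := integrable_dual_pow_conv p1 ma mU mwt aoo Un iwV.
rewrite aE/= in core.
have ea : (\int[mu]_x (`|a x| `^ p)%:E = (V t `^ p)%:E)%E.
  by rewrite -poweR_EFin -aE poweR_Lnorm ?gt_eqF.
(* Needed to split off the term in [c], whose integral is [c] times the [p]-th power of the norm. *)
have ia : mu.-integrable setT (fun x => (dual_pow p (a x) * a x)%:E).
  apply/integrableP; split.
    by apply/measurable_EFinP; apply: measurable_funM => //; exact: measurable_dual_pow.
  rewrite (_ : (\int[mu]_x _)%E = (V t `^ p)%:E) ?ltry// -ea.
  by apply: eq_integral => x _; rewrite dual_powM// gee0_abs// lee_fin powR_ge0.
have Ia : \int[mu]_x (dual_pow p (a x) * a x) = V t `^ p.
  rewrite /Rintegral -[RHS]/(fine (V t `^ p)%:E) -ea; congr fine.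
  by apply: eq_integral => x _; rewrite dual_powM.
pose h x := \int[leb]_s (wt s * U (s, x)).
(* The explicit derivative replaces [du] almost everywhere on [Omega]; outside [Omega] the slice [a]
   vanishes, so the integral may run over the whole space. *)
have -> : \int[mu]_(x in Omega) (`|u t x| `^ (p - 2) * u t x * du t x) =
    \int[mu]_x (c * (dual_pow p (a x) * a x) + dual_pow p (a x) * h x).
  have [mdu _] := (LqLpE T p1 mO 1 du).1 (let: And3 _ L _ := hdu in L).
  have /andP[/ltW t0 /ltW tT'] := tT.
  have E1 x : ((fun x => `|u t x| `^ (p - 2) * u t x * du t x) \_ Omega) x =
      dual_pow p (a x) * zero_ext T Omega du (t, x).
    rewrite patchE; case: ifPn => [/set_mem Ox|].
      by rewrite /a UE// zero_extE// t0.
    by rewrite notin_setE => Ox; rewrite zero_ext_out// mulr0.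
  rewrite Rintegral_mkcond; under eq_Rintegral do rewrite E1.
  rewrite /Rintegral; congr fine; apply: ae_eq_integral => //.
  - apply/measurable_EFinP; apply: measurable_funM.
      exact: measurable_dual_pow.
    by apply: (measurableT_comp mdu); exact: measurable_pair1.
  - apply/measurable_EFinP; apply: measurable_funD.
      apply/measurable_EFinP.
      exact: measurable_int _ (integrableZlR measurableT c ia).
    by apply/measurable_EFinP; exact: measurable_int _ icore.
  apply: ae_imply duE _ => x dux _; have [Ox|Ox] := pselect (Omega x).
    rewrite zero_extE ?t0// dux// /du0 /S /time_conv /line_conv/= -/(h x) /a.
    by congr EFin; rewrite mulrDr mulrCA.
  by rewrite zero_ext_out// /a UoutO// /dual_pow !(mulr0, mul0r) addr0.
rewrite RintegralD//; last exact: integrableZlR.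
rewrite RintegralZl// Ia Vt /dn0 mulrDr lerD//.
by rewrite mulrCA [V t `^ (p - 1) * _]mulrC mulr_powRB1.
Qed.

End main.

(** The existence clauses keep the inequality from being vacuous; as it is claimed for all weak
    derivatives, it does not depend on their representatives. *)
Theorem lemma3p1 (R : realType) (p T : R) (N : nat) (Omega : set (Rn R N))
    (k : R -> R) (u : R -> Rn R N -> R) :
  1 < p -> 0 < T -> measurable Omega ->
  W11 T k ->
  (forall t, 0 <= t <= T -> 0 <= k t) ->
  (forall s t, 0 <= s -> s <= t -> t <= T -> k t <= k s) ->
  LqLp Omega T p p u ->
  let normu t := fine (Lp_norm Omega p (u t)) in
  [/\ exists dn, weak_derivative T (conv k normu) dn,
      exists du, weak_time_derivative Omega T p (vconv k u) du
    & forall dn du,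
        weak_derivative T (conv k normu) dn ->
        weak_time_derivative Omega T p (vconv k u) du ->
        {ae @lebesgue_measure R, forall t, 0 < t < T ->
          normu t `^ (p - 1) * dn t <=
          \int[lebesgueRn R N]_(x in Omega)
            (`|u t x| `^ (p - 2) * u t x * du t x)} ].
Proof.
move=> p1 T0 mO kW _ kmono uL normu.
have kmono' s t : 0 < s -> s <= t -> t < T -> k t <= k s.
  by move=> s0 st tT; apply: kmono => //; exact: ltW.
have [c [w [iw w0 wout kE]]] := W11_nonincreasing T0 kW kmono'.
split.
- by eexists; exact: (weak_derivative_conv_norm p1 T0 mO kW uL iw wout kE).
- by eexists; exact: (weak_time_derivative_vconv p1 T0 mO kW uL iw wout kE).
- move=> dn du; exact: (ae_fundamental_inequality p1 T0 mO kW uL iw w0 wout kE).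
Qed.
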